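(* There exists a unique $r\in(\rho,1)$ such that the equation $\mathcal{R}_r\mathcal{D}=r^2\mathcal{D}$ has a solution $\mathcal{D}\in\mathcal{M}_S$.
   Context: Let $q_0=(\tfrac12,\tfrac{\sqrt3}{2})$, $q_1=(0,0)$, $q_2=(1,0)$, $\rho=\frac{\sqrt5-1}{2}$, $F_0(x)=\rho^2(x-q_0)+q_0$, $F_1(x)=\rho(x-q_1)+q_1$, $F_2(x)=\rho(x-q_2)+q_2$. For a finite word $w$ over $\{0,1,2\}$, $|w|$ is its length and $F_w=F_{w_1}\circ\cdots\circ F_{w_{|w|}}$. $W_1$ is a set of words of the form $w_1\cdots w_n0$ ($n\ge0$, $w_i\in\{1,2\}$) containing exactly one word for each distinct map $F_w$ of this form. $V_0=\{q_0,q_1,q_2\}$, $V_1=\bigcup_{w\in W_1}F_wV_0$. $\mathcal{M}$ is the set of forms $\mathcal{D}(f,g)=\frac12\sum_{i,j}a_{ij}(f(q_i)-f(q_j))(g(q_i)-g(q_j))$ on functions on $V_0$ with $(a_{ij})$ symmetric, $a_{ii}=0$, $a_{ij}\ge0$ and irreducible; $\mathcal{M}_S$ is the subset with $a_{01}=a_{02}$. $\Psi_r\mathcal{D}(f,g)=\sum_{w\in W_1}r^{-|w|+1}\mathcal{D}(f\circ F_w,g\circ F_w)$ on $\mathrm{Dom}(\Psi_r\mathcal{D})=\{f:V_1\to\mathbb{R}:\Psi_r\mathcal{D}(f,f)<\infty\}$, and for $\rho<r<1$, $\mathcal{R}_r\mathcal{D}(u)=\inf\{\Psi_r\mathcal{D}(f):f\in\mathrm{Dom}(\Psi_r\mathcal{D}),f|_{V_0}=u\}$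 for $u:V_0\to\mathbb{R}$.
   Formalization: The points q_1, q_2 do not lie in V_1, so f|_{V_0}=u is undefined as written; it is read as: f takes the values u on V_0 and is continuous at each q_i relative to V_1, i.e. u(q_1), u(q_2) are the limits of f along V_1. *)

(* Defs.v *)
From HB Require Import structures.
From mathcomp Require Import all_boot all_order all_algebra.
From mathcomp Require Import all_classical all_reals.
From mathcomp Require Import ereal esum.

Set Implicit Arguments.
Unset Strict Implicit.
Unset Printing Implicit Defensive.

Import Order.TTheory GRing.Theory Num.Theory.
Local Open Scope classical_set_scope.
Local Open Scope ring_scope.

Section GoldenGasket.
Variable R : realType.

Definition pt := (R * R)%type.

Definition rho : R := (Num.sqrt 5 - 1) / 2.

Definition q (i : 'I_3) : pt :=
  match val i with
  | 0 => (1 / 2, Num.sqrt 3 / 2)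
  | 1 => (0, 0)
  | _ => (1, 0)
  end.

Definition ratio (i : nat) : R := if i == 0%N then rho ^+ 2 else rho.

(* letter of the alphabet {0,1,2} as a vertex index (letters > 2 never
   occur in the words considered; they are sent to q_2 harmlessly) *)
Definition qn (i : nat) : pt := q (inord i).

Definition F (i : nat) (x : pt) : pt :=
  (ratio i * (x.1 - (qn i).1) + (qn i).1,
   ratio i * (x.2 - (qn i).2) + (qn i).2).

Definition Fw (w : seq nat) (x : pt) : pt := foldr F x w.

Definition wordform (w : seq nat) : Prop :=
  exists s : seq nat, all (fun i => (i == 1%N) || (i == 2%N)) s /\ w = rcons s 0%N.

Definition valid_W1 (W1 : set (seq nat)) : Prop :=
  (forall w, W1 w -> wordform w) /\
  (forall w, wordform w ->
     exists! w', W1 w' /\ (forall x, Fw w' x = Fw w x)).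

Definition V1 (W1 : set (seq nat)) : set pt :=
  [set x | exists w, W1 w /\ exists i : 'I_3, x = Fw w (q i)].

(* The form D(f,g) = 1/2 sum_{i,j} a_ij (f q_i - f q_j)(g q_i - g q_j)
   on functions on V_0 (= functions 'I_3 -> R, u i standing for u(q_i)). *)
Definition Dform (a : 'M[R]_3) (f g : 'I_3 -> R) : R :=
  2^-1 * \sum_(i < 3) \sum_(j < 3) a i j * (f i - f j) * (g i - g j).

Definition irreducible_mx (a : 'M[R]_3) : Prop :=
  forall i j : 'I_3, connect (fun k l => 0 < a k l) i j.

Definition in_M (a : 'M[R]_3) : Prop :=
  (forall i j, a i j = a j i) /\
  (forall i, a i i = 0) /\
  (forall i j, 0 <= a i j) /\
  irreducible_mx a.

Definition in_MS (a : 'M[R]_3) : Prop :=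
  in_M a /\ a (inord 0) (inord 1) = a (inord 0) (inord 2).

Definition Psi (W1 : set (seq nat)) (r : R) (a : 'M[R]_3) (f : pt -> R)
  : \bar R :=
  \esum_(w in W1)
     ((r ^- (size w - 1)%N) *
       Dform a (fun i => f (Fw w (q i))) (fun i => f (Fw w (q i))))%:E.

(* Admissible f for boundary data u: f in Dom(Psi_r D) and f|_{V_0} = u,
   where the value of f at q_i is the (V_1-)limit value, i.e. f is
   continuous at each q_i relative to V_1. *)
Definition admissible (W1 : set (seq nat)) (r : R) (a : 'M[R]_3)
  (u : 'I_3 -> R) (f : pt -> R) : Prop :=
  (Psi W1 r a f < +oo)%E /\
  (forall i, f (q i) = u i) /\
  (forall i (e : R), 0 < e -> exists2 d : R, 0 < d &
     forall x, V1 W1 x ->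
       Num.max `|x.1 - (q i).1| `|x.2 - (q i).2| < d ->
       `|f x - f (q i)| < e).

Definition Rr (W1 : set (seq nat)) (r : R) (a : 'M[R]_3) (u : 'I_3 -> R)
  : \bar R :=
  ereal_inf [set Psi W1 r a f | f in admissible W1 r a u].

End GoldenGasket.

(* Main.v *)
Require Import Defs.
From HB Require Import structures.
From mathcomp Require Import all_boot all_order all_algebra.
From mathcomp Require Import all_classical all_reals.
From mathcomp Require Import ereal esum.
From mathcomp Require Import sequences fsbigop cardinality filter normedtype.
From mathcomp Require Import ring lra zify.
Import Order.TTheory GRing.Theory Num.Theory.
Local Open Scope classical_set_scope.
Local Open Scope ring_scope.

(* The points of V_1 form an infinite graph: the node F_w q_0, w a word over {1,2} of
   length n, has the two children F_{w1} q_0 and F_{w2} q_0, and the cell F_{w0} V_0 is the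
   triangle on a node and its children.  Since F_{122} = F_{211}, neighbouring nodes of one
   level lie at distance rho^(n+1) (siblings) or rho^(n+2) (nodes with a common child).

   Up to scaling a form in M_S is s + t tau with t >= 1, where s and tau are the squares of
   the symmetric and the antisymmetric part of a function on V_0.  By reflection
   R_r(s + t tau) = A(r,t) s + G(r,t) tau, and A, G are nondecreasing in t, nonincreasing
   in r, and homogeneous enough that A(r,t)/t and G(r,t)/t are nonincreasing in t.  So one
   has to solve A = r^2, G = t r^2.

   Uniqueness: if r < r' both admit solutions, compare A when t' <= t and G when t <= t'.
   Existence: for fixed r one has G >= A at t = 1 (contraction), and G <= t A for large t,
   because the affine function of x, set to zero above a deep level, has finite symmetric
   energy while its antisymmetric energy is a geometric tail of ratio rho/r < 1.  So
   G = t A for some t(r), and it remains to let r vary.  At r = 5/8 both A and G are at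
   least r^2 for t = 1 by a flow along the sides, while A < r^2 for r >= 9/10.  The supremum
   of the r with A >= r^2 and G >= t r^2 for some t is the solution, once A and G are known
   to be continuous in r.  For that, cut a near-minimizer at a level where it has little
   energy and extend it linearly below the cut: linear interpolation preserves the
   one-dimensional Dirichlet integral, so the extension costs a bounded multiple of the
   energy at the cut, for every r > rho. *)

(** * Levels of the graph *)

(* Gaps between consecutive nodes of a level, from left to right: [true] between siblings
   (length rho^(n+1)), [false] between nodes with a common child (length rho^(n+2)).  A node
   creates the [true] gap between its children; a [true] gap also leaves a [false] one. *)
Fixpoint refine (p : seq bool) : seq bool :=
  match p with
  | [::] => [:: true]
  | b :: p' => if b then [:: true, false & refine p'] else true :: refine p'
  end.

Fixpoint pattern (n : nat) : seq bool :=
  if n is n'.+1 then refine (pattern n') else [::].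

(* Index of the left child of node [i]; the right child has the next index. *)
Definition child (p : seq bool) (i : nat) : nat := (i + count id (take i p))%N.

Lemma child0 p : child p 0 = 0%N.
Proof. by rewrite /child take0. Qed.

Lemma child_cons b p i : child (b :: p) i.+1 = (child p i + b).+1.
Proof. by rewrite /child /=; lia. Qed.

Lemma size_refine p : size (refine p) = (child p (size p)).+1.
Proof.
by elim: p => [|[] p IH] //=; rewrite IH child_cons ?addn0 ?addn1.
Qed.

Lemma leq_child p i j : (i <= j)%N -> (child p i <= child p j)%N.
Proof.
elim: p i j => [|b p IH] [|i] [|j] //; rewrite ?child0 // => h.
  by rewrite /child /=; lia.
by rewrite !child_cons ltnS leq_add2r IH.
Qed.

Lemma child_bound p i : (i <= size p)%N -> (child p i < size (refine p))%N.
Proof. by move=> h; rewrite size_refine ltnS leq_child. Qed.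

Lemma child_surj p j : (j <= size (refine p))%N ->
  exists2 i, (i <= size p)%N & j = child p i \/ j = (child p i).+1.
Proof.
elim: p j => [|b p IH] j /=.
  by rewrite leq_eqVlt => /orP[/eqP->|]; [exists 0%N; auto|case: j => // _; exists 0%N; auto].
case: j => [|j] h; first by exists 0%N; rewrite // child0; left.
case: b h => /=.
  case: j => [|j] h; first by exists 0%N; rewrite // child0; right.
  have [i hi hj] := IH j h; exists i.+1 => //.
  by rewrite child_cons addn1; case: hj => ->; [left|right].
move=> h; have [i hi hj] := IH j h; exists i.+1 => //.
by rewrite child_cons addn0; case: hj => ->; [left|right].
Qed.

Lemma refine_rcons p b :
  refine (rcons p b) = refine p ++ (if b then [:: false; true] else [:: true]).
Proof. by elim: p => [|[] p IH] /=; [case: b|rewrite IH|rewrite IH]. Qed.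

(** The mirror symmetry of the gasket; it makes every [pattern] a palindrome. *)
Lemma rev_refine p : rev (refine p) = refine (rev p).
Proof.
elim: p => [|[] p IH] //=; rewrite !rev_cons refine_rcons -IH -!cats1 -?catA //.
Qed.

Lemma rev_pattern n : rev (pattern n) = pattern n.
Proof. by elim: n => //= n IH; rewrite rev_refine IH. Qed.

(** Reflection exchanges the two children of a node, hence the successor: the left child of the
    mirror node is the mirror of the right child. *)
Lemma child_rev n i : (i <= size (pattern n))%N ->
  child (pattern n) (size (pattern n) - i) =
  (size (pattern n.+1) - (child (pattern n) i).+1)%N.
Proof.
move=> h; set p := pattern n; rewrite [pattern n.+1]/= -/p size_refine subSS /child take_size.
have rp : rev p = p := rev_pattern n.
have -> : count id (take (size p - i) p) = count id (drop i p).
  by rewrite -{2}rp take_rev count_rev subKn.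
have := congr1 (count id) (cat_take_drop i p); rewrite count_cat => <-.
by rewrite -/p in h; lia.
Qed.

(** * Positions of the nodes on the line *)

Section Model.
Variable R : realType.
Local Notation rho := (rho R).
Implicit Types (p : seq bool) (v : nat -> R) (phi psi : nat -> nat -> R).

Lemma sqrt5_bounds : 11 / 5 < Num.sqrt (5 : R) < 56 / 25.
Proof.
have h : Num.sqrt (5 : R) ^+ 2 = 5 by rewrite sqr_sqrtr.
have h0 := sqrtr_ge0 (5 : R); by apply/andP; split; nra.
Qed.

Lemma rho_bounds : 3 / 5 < rho < 31 / 50.
Proof. by have /andP[h1 h2] := sqrt5_bounds; rewrite /Defs.rho; apply/andP; split; lra. Qed.

Lemma rho_gt0 : 0 < rho. Proof. by have := rho_bounds; lra. Qed.
Lemma rho_lt1 : rho < 1. Proof. by have := rho_bounds; lra. Qed.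

Lemma rho_sqr : rho * rho = 1 - rho.
Proof.
have h : Num.sqrt (5 : R) ^+ 2 = 5 by rewrite sqr_sqrtr.
rewrite /Defs.rho; nra.
Qed.

Definition gap_length (b : bool) : R := if b then 1 else rho.

Lemma gap_length_ge b : rho <= gap_length b.
Proof. by case: b => /=; have := rho_lt1; lra. Qed.

(** Distance from the left end in units of rho^(n+1), n being the level. The default [true] keeps
    gaps past the end positive, so that monotonicity holds for all indices. *)
Definition offset p (i : nat) : R := \sum_(j < i) gap_length (nth true p j).

Lemma offset0 p : offset p 0 = 0. Proof. exact: big_ord0. Qed.

Lemma offset_cons b p i : offset (b :: p) i.+1 = gap_length b + offset p i.
Proof. by rewrite /offset big_ord_recl. Qed.

Lemma offset_add_ge p i j : rho * j%:R <= offset p (i + j) - offset p i.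
Proof.
rewrite /offset big_split_ord /= [X in _ <= X]addrAC subrr add0r.
apply: le_trans (_ : \sum_(k < j) rho <= _); last by apply: ler_sum => k _; exact: gap_length_ge.
by rewrite sumr_const card_ord mulr_natr.
Qed.

Lemma offset_ltS p i j : (i < j)%N -> offset p i + rho <= offset p j.
Proof.
move=> h; have := offset_add_ge p i (j - i); rewrite subnKC ?(ltnW h) // => h2.
have : 1 <= (j - i)%:R :> R by rewrite ler1n subn_gt0.
have := rho_gt0; nra.
Qed.

Lemma offset_le p i j : (i <= j)%N -> offset p i <= offset p j.
Proof.
rewrite leq_eqVlt => /orP[/eqP->//|/(offset_ltS p)]; have := rho_gt0; lra.
Qed.

Lemma offset_ge0 p i : 0 <= offset p i.
Proof. by rewrite -(offset0 p) offset_le. Qed.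

(** A left child sits where its parent does, measured in a unit shorter by the factor rho, and 1 /
    rho = 1 + rho by [rho_sqr]. *)
Lemma offset_child p i : (i <= size p)%N ->
  offset (refine p) (child p i) = (1 + rho) * offset p i.
Proof.
elim: p i => [|b p IH] [|i] //; rewrite ?child0 ?offset0 ?mulr0 //= ltnS => h.
rewrite child_cons; case: b => /=; rewrite ?addn1 ?addn0 !offset_cons IH //=;
 by have := rho_sqr; lra.
Qed.

Lemma nth_refine_child p i : (i <= size p)%N -> nth true (refine p) (child p i) = true.
Proof.
elim: p i => [|b p IH] [|i] //=; rewrite ?child0 //; first by case: b.
by rewrite ltnS => h; rewrite child_cons; case: b; rewrite ?addn1 ?addn0 /= IH.
Qed.

Lemma offset_childS p i : (i <= size p)%N ->
  offset (refine p) (child p i).+1 = (1 + rho) * offset p i + 1.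
Proof.
move=> h; rewrite {1}/offset big_ord_recr /= nth_refine_child // -offset_child //.
Qed.

Definition pos n i : R := rho ^+ n.+1 * offset (pattern n) i.

Lemma pos0 n : pos n 0 = 0. Proof. by rewrite /pos offset0 mulr0. Qed.

Lemma pos_ge0 n i : 0 <= pos n i.
Proof. by rewrite mulr_ge0 ?offset_ge0 ?exprn_ge0 // ltW ?rho_gt0. Qed.

Lemma pos_lt n i j : (i < j)%N -> pos n i < pos n j.
Proof.
move=> h; rewrite /pos ltr_pM2l ?exprn_gt0 ?rho_gt0 //.
by have := offset_ltS (pattern n) i j h; have := rho_gt0; lra.
Qed.

Lemma pos_inj n i j : pos n i = pos n j -> i = j.
Proof.
by move=> e; case: (ltngtP i j) => // /(pos_lt n); rewrite e ltxx.
Qed.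

Lemma pos_child n i : (i <= size (pattern n))%N ->
  pos n.+1 (child (pattern n) i) = pos n i.
Proof.
move=> h; have e : rho * (1 + rho) = 1 by have := rho_sqr; lra.
by rewrite /pos /= offset_child // exprSr mulrA -(mulrA (rho ^+ _)) e mulr1.
Qed.

Lemma pos_childS n i : (i <= size (pattern n))%N ->
  pos n.+1 (child (pattern n) i).+1 = pos n i + rho ^+ n.+2.
Proof.
by move=> h; rewrite -(pos_child n i h) /pos /= offset_childS // offset_child // mulrDr mulr1.
Qed.

Lemma pos_last n : pos n (size (pattern n)) = 1 - rho ^+ n.
Proof.
elim: n => [|n IH]; first by rewrite pos0 expr0 subrr.
rewrite /= size_refine pos_childS // IH !exprSr -mulrA rho_sqr; ring.
Qed.

Lemma offset_rev n i : (i <= size (pattern n))%N ->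
  offset (pattern n) (size (pattern n) - i) + offset (pattern n) i
  = offset (pattern n) (size (pattern n)).
Proof.
set p := pattern n => h; have rp : rev p = p := rev_pattern n.
suff -> : offset p i = \sum_(j < i) gap_length (nth true p (size p - i + j)).
  by rewrite -[X in _ = offset p X](subnK h) /offset big_split_ord.
rewrite /offset [RHS](reindex_inj rev_ord_inj) /=; apply: eq_bigr => j _.
rewrite -{1}rp nth_rev ?(leq_trans (ltn_ord j)) //; congr (gap_length (nth _ _ _)).
have := ltn_ord j; lia.
Qed.

Lemma pos_rev n i : (i <= size (pattern n))%N ->
  pos n (size (pattern n) - i) = 1 - rho ^+ n - pos n i.
Proof.
move=> h; rewrite -pos_last /pos -(offset_rev n i h); ring.
Qed.

End Model.

(** * Energies and linear interpolation *)

Section Energy.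
Variable R : realType.
Local Notation rho := (rho R).
Implicit Types (p : seq bool) (v : nat -> R) (phi psi : nat -> nat -> R) (d : R -> R -> R -> R).

Definition cellsum d p v v' : R :=
  \sum_(i < (size p).+1) d (v i) (v' (child p i)) (v' (child p i).+1).

Lemma cellsum_nil d v v' : cellsum d [::] v v' = d (v 0%N) (v' 0%N) (v' 1%N).
Proof. by rewrite /cellsum big_ord_recl big_ord0 addr0 child0. Qed.

Lemma cellsum_cons d b p v v' :
  cellsum d (b :: p) v v' = d (v 0%N) (v' 0%N) (v' 1%N)
    + cellsum d p (fun i => v i.+1) (fun i => v' (i + b).+1).
Proof.
rewrite /cellsum big_ord_recl child0; congr (_ + _); apply: eq_bigr => i _.
by rewrite lift0 child_cons.
Qed.

Lemma cellsum_ge0 d p v v' : (forall x y z, 0 <= d x y z) -> 0 <= cellsum d p v v'.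
Proof. by move=> h; apply: sumr_ge0. Qed.

Lemma ler_cellsum d1 d2 p v v' : (forall x y z, d1 x y z <= d2 x y z) ->
  cellsum d1 p v v' <= cellsum d2 p v v'.
Proof. by move=> h; apply: ler_sum. Qed.

Lemma cellsumZ d c p v v' :
  cellsum (fun x y z => c * d x y z) p v v' = c * cellsum d p v v'.
Proof. by rewrite /cellsum mulr_sumr. Qed.

Definition level d phi n := cellsum d (pattern n) (phi n) (phi n.+1).

Definition reflect phi : nat -> nat -> R := fun n i => phi n (size (pattern n) - i)%N.

Lemma reflectK phi n i : (i <= size (pattern n))%N -> reflect (reflect phi) n i = phi n i.
Proof. by move=> h; rewrite /reflect subKn. Qed.

Lemma level_reflect d phi n : (forall x y z, d x z y = d x y z) ->
  level d (reflect phi) n = level d phi n.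
Proof.
move=> sd; rewrite /level /cellsum [RHS](reindex_inj rev_ord_inj) /=.
apply: eq_bigr => i _; have hi : (i <= size (pattern n))%N by rewrite -ltnS.
rewrite subSS child_rev // /reflect -sd; congr (d _ (phi _ _) (phi _ _)).
have := child_bound _ _ hi; rewrite /=; lia.
Qed.

(** A word of level m ends in 0 and has length m + 1, which gives the weight r^-m. Finite total
    energy becomes a bound uniform in [n]. *)
Definition energy d (r : R) phi n : R := \sum_(m < n) r ^- m * level d phi m.

Lemma energy_ge0 d r phi n : 0 < r -> (forall x y z, 0 <= d x y z) -> 0 <= energy d r phi n.
Proof.
move=> r0 d0; apply: sumr_ge0 => i _.
by rewrite mulr_ge0 ?cellsum_ge0 // invr_ge0 exprn_ge0 // ltW.
Qed.

Lemma energy_mono d r phi n m : 0 < r -> (forall x y z, 0 <= d x y z) -> (n <= m)%N ->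
  energy d r phi n <= energy d r phi m.
Proof.
move=> r0 d0 /subnKC <-; rewrite /energy big_split_ord /= lerDl sumr_ge0 // => i _.
by rewrite mulr_ge0 ?cellsum_ge0 // invr_ge0 exprn_ge0 // ltW.
Qed.

(** The form s + t tau on a node and its children. At t = 1 it is (x - y)^2 + (x - z)^2; a larger t
    adds a conductance (t - 1) / 2 between the children. *)
Definition cell_form (t x y z : R) : R := (2 * x - y - z) ^+ 2 / 2 + t * ((y - z) ^+ 2 / 2).

Lemma cell_form_ge0 t x y z : 0 <= t -> 0 <= cell_form t x y z.
Proof.
by move=> t0; rewrite /cell_form; have := sqr_ge0 (2 * x - y - z); have := sqr_ge0 (y - z); nra.
Qed.

Lemma cell_form_swap t x y z : cell_form t x z y = cell_form t x y z.
Proof. rewrite /cell_form; ring. Qed.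

Lemma cell_form_ge t x y z : 1 <= t -> (x - y) ^+ 2 + (x - z) ^+ 2 <= cell_form t x y z.
Proof. by move=> t1; rewrite /cell_form; have := sqr_ge0 (y - z); nra. Qed.

(** Linear interpolation at the refined nodes: a [true] gap receives one new node, at the fraction
    rho of its length, a [false] gap none. Past the last node the value stays constant. *)
Fixpoint interp p v (j : nat) : R :=
  match p, j with
  | [::], _ => v 0%N
  | _ :: _, 0%N => v 0%N
  | true :: _, 1%N => (1 - rho) * v 0%N + rho * v 1%N
  | true :: p', j'.+2 => interp p' (fun i => v i.+1) j'
  | false :: p', j'.+1 => interp p' (fun i => v i.+1) j'
  end.

Lemma interp0 p v : interp p v 0 = v 0%N.
Proof. by case: p => [|[]]. Qed.

Lemma interp_last p v : interp p v (size (refine p)) = v (size p).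
Proof. by elim: p v => [|[] p IH] v //=; rewrite IH. Qed.

Definition dirichlet p v : R := \sum_(i < size p) (v i.+1 - v i) ^+ 2 / gap_length R (nth true p i).

Lemma dirichlet_nil v : dirichlet [::] v = 0. Proof. exact: big_ord0. Qed.

Lemma dirichlet_cons b p v :
  dirichlet (b :: p) v = (v 1%N - v 0%N) ^+ 2 / gap_length R b + dirichlet p (fun i => v i.+1).
Proof. by rewrite /dirichlet big_ord_recl. Qed.

Lemma dirichlet_ge0 p v : 0 <= dirichlet p v.
Proof.
apply: sumr_ge0 => i _; rewrite divr_ge0 ?sqr_ge0 //.
by apply: le_trans (gap_length_ge _ _); apply/ltW/rho_gt0.
Qed.

(** Interpolation preserves the integral; the factor rho records the change of the unit of length.
    The last new gap contributes 0, the extension being constant there. *)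
Lemma dirichlet_interp p v : dirichlet (refine p) (interp p v) = rho * dirichlet p v.
Proof.
have r0 : rho != 0 by rewrite gt_eqF // rho_gt0.
elim: p v => [|b p IH] v.
  by rewrite /= dirichlet_cons /= subrr !dirichlet_nil; ring.
case: b => /=.
  rewrite !dirichlet_cons /= IH interp0 /gap_length.
  have -> : (1 - rho) * v 0%N + rho * v 1%N - v 0%N = rho * (v 1%N - v 0%N) by ring.
  have -> : v 1%N - ((1 - rho) * v 0%N + rho * v 1%N) = (1 - rho) * (v 1%N - v 0%N) by ring.
  rewrite -rho_sqr; set x := v 1%N - v 0%N; rewrite [RHS]mulrDr addrA; congr (_ + _).
  have -> : (rho * rho * x) ^+ 2 / rho = rho * rho * rho * x ^+ 2 by field.
  by transitivity (rho * x ^+ 2 * (rho + rho * rho)); [field|rewrite rho_sqr; field].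
by rewrite !dirichlet_cons /= IH interp0 /gap_length; field.
Qed.

(** The left child inherits the value of its parent, so each cell contributes some [d x x z]. Here z
    - x is rho times the increment over a [true] gap or the full increment over a [false] one, and
    rho^2 <= rho. *)
Lemma cellsum_interp d p v (C : R) : 0 <= C -> (forall x z, d x x z <= C * (z - x) ^+ 2) ->
  cellsum d p v (interp p v) <= C * (rho * dirichlet p v).
Proof.
have r0 := rho_gt0 R; have rn : rho != 0 by rewrite gt_eqF.
move=> C0 hd; elim: p v => [|b p IH] v.
  by rewrite cellsum_nil dirichlet_nil /=; apply: le_trans (hd _ _) _; rewrite subrr; lra.
rewrite cellsum_cons dirichlet_cons mulrDr mulrDr.
case: b => /=.
  apply: lerD; last first.
    by apply: le_trans (IH _); rewrite le_eqVlt /cellsum; apply/orP; left; apply/eqP; apply: eq_bigr => i _; rewrite !addn1.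
  apply: le_trans (hd _ _) _; rewrite ler_wpM2l // divr1.
  have -> : (1 - rho) * v 0%N + rho * v 1%N - v 0%N = rho * (v 1%N - v 0%N) by ring.
  rewrite exprMn ler_wpM2r ?sqr_ge0 // expr2.
  by have := rho_lt1 R; nra.
apply: lerD; last first.
  by apply: le_trans (IH _); rewrite le_eqVlt /cellsum; apply/orP; left; apply/eqP; apply: eq_bigr => i _; rewrite !addn0.
apply: le_trans (hd _ _) _; rewrite ler_wpM2l // interp0.
by rewrite mulrCA mulfV ?mulr1.
Qed.

Definition gapsum (b : bool) p v : R :=
  \sum_(i < size p) (if nth true p i == b then (v i.+1 - v i) ^+ 2 else 0).

Lemma gapsum_nil b v : gapsum b [::] v = 0. Proof. exact: big_ord0. Qed.

Lemma gapsum_cons b a p v : gapsum b (a :: p) v =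
  (if a == b then (v 1%N - v 0%N) ^+ 2 else 0) + gapsum b p (fun i => v i.+1).
Proof. by rewrite /gapsum big_ord_recl. Qed.

Lemma dirichletE p v : dirichlet p v = gapsum true p v + gapsum false p v / rho.
Proof.
elim: p v => [|b p IH] v; first by rewrite dirichlet_nil !gapsum_nil mul0r addr0.
rewrite dirichlet_cons !gapsum_cons IH; case: b => /=; rewrite ?divr1 ?mulrDl; ring.
Qed.

Lemma gapsum_long p v v' :
  gapsum true (refine p) v' = cellsum (fun x y z => (y - z) ^+ 2) p v v'.
Proof.
elim: p v v' => [|b p IH] v v'.
  by rewrite /= gapsum_cons gapsum_nil cellsum_nil /= addr0; ring.
rewrite cellsum_cons; case: b => /=; rewrite !gapsum_cons /=.
  rewrite (IH (fun i => v i.+1)) add0r; congr (_ + _); first by ring.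
  by apply: eq_bigr => i _; rewrite !addn1.
rewrite (IH (fun i => v i.+1)); congr (_ + _); first by ring.
by apply: eq_bigr => i _; rewrite !addn0.
Qed.

(** A [false] gap is bridged by the common child c of its ends: (x - y)^2 <= 2 (x - c)^2 + 2 (c -
    y)^2. The extra term on the left reserves the leftmost edge, which the induction spends on a
    [false] gap in front of the list. *)
Lemma gapsum_short p v v' :
  gapsum false p v + 2 * (v 0%N - v' 0%N) ^+ 2
  <= 2 * cellsum (fun x y z => (x - y) ^+ 2 + (x - z) ^+ 2) p v v'.
Proof.
elim: p v v' => [|b p IH] v v'.
  rewrite gapsum_nil cellsum_nil; have := sqr_ge0 (v 0%N - v' 1%N); lra.
rewrite cellsum_cons gapsum_cons.
have := IH (fun i => v i.+1) (fun i => v' (i + b).+1).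
set A := cellsum _ _ _ _; set B := gapsum _ _ _ => /=.
case: b @A => A /=; rewrite ?addn0 => h.
  have := sqr_ge0 (v 0%N - v' 1%N); have := sqr_ge0 (v 1%N - v' (0 + 1).+1); lra.
have := sqr_ge0 (v 0%N + v 1%N - 2 * v' 1%N); nra.
Qed.

(** Long gaps are controlled by the cells of the level above, short gaps by those of the level
    below. This bounds the cost of a linear extension by the energy next to the cut. *)
Lemma dirichlet_le_cellsum (t : R) p v v' v'' : 1 <= t ->
  dirichlet (refine p) v' <=
    4 * (cellsum (cell_form t) p v v' + cellsum (cell_form t) (refine p) v' v'').
Proof.
move=> t1; rewrite dirichletE (gapsum_long _ v).
have h1 : cellsum (fun x y z => (y - z) ^+ 2) p v v' <= 2 * cellsum (cell_form t) p v v'.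
  rewrite -cellsumZ; apply: ler_cellsum => x y z.
  have := cell_form_ge t x y z t1; have := sqr_ge0 (2 * x - y - z); nra.
have h2 : cellsum (fun x y z => (x - y) ^+ 2 + (x - z) ^+ 2) (refine p) v' v''
          <= cellsum (cell_form t) (refine p) v' v''.
  by apply: ler_cellsum => x y z; apply: cell_form_ge.
have h3 := gapsum_short (refine p) v' v''; have h4 := sqr_ge0 (v' 0%N - v'' 0%N).
have c0 q u u' : 0 <= cellsum (cell_form t) q u u'.
  by apply: cellsum_ge0 => x y z; apply: cell_form_ge0; lra.
have := c0 p v v'; have := c0 (refine p) v' v''.
have /andP[r1 r2] := rho_bounds R.
have : gapsum false (refine p) v' / rho <= 4 * cellsum (cell_form t) (refine p) v' v''.
  rewrite ler_pdivrMr ?rho_gt0 //; have := c0 (refine p) v' v''; nra.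
lra.
Qed.

End Energy.

(** * Linear extension below a level, and values at the corners *)

Section Extension.
Variable R : realType.
Local Notation rho := (rho R).
Implicit Types (p : seq bool) (v : nat -> R) (phi psi : nat -> nat -> R) (d : R -> R -> R -> R).

Lemma geometric_sum_le (x : R) n : 0 <= x < 1 -> \sum_(i < n) x ^+ i <= (1 - x)^-1.
Proof.
move=> /andP[x0 x1]; have h : 0 < 1 - x by lra.
rewrite -[_^-1]mulr1 ler_pdivlMl // -[1 - x]opprB mulNr -subrX1 opprB.
by rewrite gerBl exprn_ge0.
Qed.

Lemma expr_small (x e : R) : 0 <= x < 1 -> 0 < e ->
  exists N, forall n, (N <= n)%N -> x ^+ n < e.
Proof.
move=> /andP[x0 x1] e0.
have [N hN] : exists N, e^-1 < N%:R * (1 - x).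
  have h : 0 <= e^-1 / (1 - x) by rewrite divr_ge0 ?invr_ge0 ?(ltW e0) // subr_ge0 ltW.
  exists (Num.bound (e^-1 / (1 - x))); rewrite -ltr_pdivrMr ?subr_gt0 //.
  exact: archi_boundP.
exists N => n Nn; have bern k : x ^+ k * (1 + k%:R * (1 - x)) <= 1.
  elim: k => [|k IH]; first by rewrite expr0 mul0r addr0 mul1r.
  rewrite exprS; have := exprn_ge0 k x0; set y := x ^+ k in IH *.
  rewrite -natr1 => y0; have k0 : 0 <= k%:R :> R by exact: ler0n.
  set m := k%:R in IH k0 *.
  have : 0 <= y * (1 - x) * (1 - x) * (m + 1) by rewrite !mulr_ge0 // ?subr_ge0 ?(ltW x1) // addr_ge0.
  nra.
apply: le_lt_trans (_ : (1 + n%:R * (1 - x))^-1 < _).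
  have h : 0 < 1 + n%:R * (1 - x).
    by rewrite ltr_wpDr // mulr_ge0 // subr_ge0 ltW.
  by rewrite -[leRHS]mulr1 ler_pdivlMl // mulrC bern.
rewrite invf_plt ?posrE //; last by rewrite ltr_wpDr // mulr_ge0 // subr_ge0 ltW.
apply: lt_le_trans hN _; apply: le_trans (_ : n%:R * (1 - x) <= _); last by rewrite lerDr.
by apply: ler_wpM2r; [rewrite subr_ge0 ltW|rewrite ler_nat].
Qed.

(** The limit at q_1: up to constants, rho^n + pos n i is the distance of the node from q_1. The
    limit at q_2 is expressed by reflecting the function. *)
Definition corner phi u := forall e : R, 0 < e -> exists2 del : R, 0 < del &
  forall n i, (i <= size (pattern n))%N -> rho ^+ n + pos R n i < del -> `|phi n i - u| < e.

Lemma eq_corner phi psi u :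
  (forall n i, (i <= size (pattern n))%N -> phi n i = psi n i) -> corner phi u -> corner psi u.
Proof.
by move=> h hp e /hp[del d0 H]; exists del => // n i hi; rewrite -h //; exact: H.
Qed.

Lemma corner_lin phi psi u w a b : corner phi u -> corner psi w ->
  corner (fun n i => a * phi n i + b * psi n i) (a * u + b * w).
Proof.
move=> hp hq e e0; pose M := `|a| + `|b| + 1.
have M0 : 0 < M by rewrite /M; have := normr_ge0 a; have := normr_ge0 b; lra.
have [d1 d10 H1] := hp (e / M) (divr_gt0 e0 M0).
have [d2 d20 H2] := hq (e / M) (divr_gt0 e0 M0).
exists (Num.min d1 d2) => [|n i hi]; first by rewrite lt_min d10.
rewrite lt_min => /andP[/(H1 _ _ hi) h1 /(H2 _ _ hi) h2].
have -> : a * phi n i + b * psi n i - (a * u + b * w)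
          = a * (phi n i - u) + b * (psi n i - w) by ring.
apply: le_lt_trans (ler_normD _ _) _; rewrite !normrM.
have : `|a| * `|phi n i - u| <= `|a| * (e / M) by rewrite ler_wpM2l // ltW.
have : `|b| * `|psi n i - w| <= `|b| * (e / M) by rewrite ler_wpM2l // ltW.
have : (`|a| + `|b| + 1) * (e / M) = e by rewrite mulrC divfK // gt_eqF.
by have := divr_gt0 e0 M0; lra.
Qed.

Lemma corner_norm phi u : corner phi u -> corner (fun n i => `|phi n i|) `|u|.
Proof.
move=> hp e /hp[del d0 H]; exists del => // n i hi h.
exact: le_lt_trans (ler_dist_dist _ _) (H n i hi h).
Qed.

Lemma corner_lipschitz phi u (K : R) N :
  (forall n i, (N <= n)%N -> (i <= size (pattern n))%N -> `|phi n i - u| <= K * pos R n i) ->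
  corner phi u.
Proof.
move=> H e e0; have r0 := rho_gt0 R; have r1 := rho_lt1 R.
have K0 : 0 < `|K| + 1 by have := normr_ge0 K; lra.
exists (Num.min (rho ^+ N) (e / (`|K| + 1))) => [|n i hi].
  by rewrite lt_min exprn_gt0 // divr_gt0.
have p0 := pos_ge0 R n i; have e1 := exprn_gt0 n r0.
rewrite lt_min => /andP[h1 h2]; have Nn : (N <= n)%N.
  rewrite leqNgt; apply/negP => nN; have : rho ^+ N <= rho ^+ n by apply: ler_wiXn2l; rewrite ?ltW // ltnW.
  lra.
apply: le_lt_trans (H n i Nn hi) _; move: h2; rewrite ltr_pdivlMr // => h2.
have := ler_norm K; nra.
Qed.

Lemma corner_first phi u : corner phi u -> forall e : R, 0 < e ->
  exists N, forall n, (N <= n)%N -> `|phi n 0%N - u| < e.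
Proof.
move=> hp e /hp[del d0 H].
have [|N hN] := expr_small rho del _ d0; first by rewrite ltW ?rho_gt0 ?rho_lt1.
by exists N => n Nn; apply: H => //; rewrite pos0 addr0 hN.
Qed.

(** Linear interpolation keeps a Lipschitz bound measured from the left end; one unit of the new
    level is rho old units. The shift [a] is the distance already covered in the induction on the
    list. *)
Lemma interp_lip_first p v w (K a : R) : 0 <= K ->
  (forall i, (i <= size p)%N -> `|v i - w| <= K * (a + offset R p i)) ->
  forall j, (j <= size (refine p))%N ->
    `|interp R p v j - w| <= K * (a + rho * offset R (refine p) j).
Proof.
have r0 := rho_gt0 R; have r1 := rho_lt1 R.
move=> K0; elim: p v a => [|b p IH] v a H j.
  move=> _ /=; apply: le_trans (H 0%N isT) _; rewrite offset0 ler_wpM2l // lerD2l.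
  by rewrite mulr_ge0 ?offset_ge0 // ltW.
have H' i : (i <= size p)%N -> `|v i.+1 - w| <= K * (a + gap_length R b + offset R p i).
  by move=> hi; apply: le_trans (H i.+1 hi) _; rewrite offset_cons addrA.
have h0 := H 0%N isT; rewrite offset0 addr0 in h0.
case: b H H' => H H'.
  case: j => [|[|j]] hj /=; rewrite ?offset_cons ?offset0 ?mulr0 ?addr0 //.
    have h1 := H' 0%N isT; rewrite offset0 addr0 /= in h1.
    have -> : (1 - rho) * v 0%N + rho * v 1%N - w = (1 - rho) * (v 0%N - w) + rho * (v 1%N - w) by ring.
    apply: le_trans (ler_normD _ _) _; rewrite (normrM (1 - rho)) (normrM rho) (ger0_norm (ltW r0)) ger0_norm; last by lra.
    by rewrite /gap_length in h1 *; nra.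
  have := IH _ _ H' j hj; rewrite /gap_length.
  have -> : rho * (1 + (rho + offset R (refine p) j)) = 1 + rho * offset R (refine p) j.
    by have := rho_sqr R; lra.
  by rewrite addrA.
case: j => [|j] hj /=; rewrite ?offset_cons ?offset0 ?mulr0 ?addr0 //.
have := IH _ _ H' j hj; rewrite /gap_length.
have -> : rho * (1 + offset R (refine p) j) = rho + rho * offset R (refine p) j by ring.
by rewrite addrA.
Qed.

Lemma interp_lip_last p v w (K a : R) : 0 <= K -> v (size p) = w ->
  (forall i, (i <= size p)%N -> `|v i - w| <= K * (a - offset R p i)) ->
  forall j, (j <= size (refine p))%N ->
    `|interp R p v j - w| <= K * (a + rho - rho * offset R (refine p) j).
Proof.
have r0 := rho_gt0 R; have r1 := rho_lt1 R.
move=> K0; elim: p v a => [|b p IH] v a vw H j.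
  have := H 0%N isT; rewrite offset0 /= in vw *; rewrite vw subrr normr0 => h hj.
  apply: le_trans h _; rewrite ler_wpM2l //.
  case: j hj => [|[|//]] _; rewrite ?offset_cons ?offset0; rewrite /gap_length; lra.
have H' i : (i <= size p)%N -> `|v i.+1 - w| <= K * (a - gap_length R b - offset R p i).
  by move=> hi; apply: le_trans (H i.+1 hi) _; rewrite offset_cons opprD addrA.
have h0 := H 0%N isT; rewrite offset0 subr0 in h0.
case: b vw H H' => vw H H'.
  case: j => [|[|j]] hj /=; rewrite ?offset_cons ?offset0 ?mulr0 ?addr0 ?subr0 //.
  - apply: le_trans h0 _; nra.
  - have h1 := H' 0%N isT; rewrite offset0 subr0 /= in h1.
    have -> : (1 - rho) * v 0%N + rho * v 1%N - w = (1 - rho) * (v 0%N - w) + rho * (v 1%N - w) by ring.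
    apply: le_trans (ler_normD _ _) _; rewrite (normrM (1 - rho)) (normrM rho) (ger0_norm (ltW r0)) ger0_norm; last by lra.
    by rewrite /gap_length in h1 *; nra.
  have := IH _ _ vw H' j hj; rewrite /gap_length.
  have -> : rho * (1 + (rho + offset R (refine p) j)) = 1 + rho * offset R (refine p) j.
    by have := rho_sqr R; lra.
  by rewrite opprD addrA [a - 1 + rho]addrAC.
case: j => [|j] hj /=; rewrite ?offset_cons ?offset0 ?mulr0 ?addr0 ?subr0 //.
  by apply: le_trans h0 _; nra.
have := IH _ _ vw H' j hj; rewrite /gap_length.
have -> : rho * (1 + offset R (refine p) j) = rho + rho * offset R (refine p) j by ring.
by rewrite opprD addrA [a - rho + rho]addrAC.
Qed.

Fixpoint extend N phi n : nat -> R :=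
  if n is n'.+1 then
    if (n'.+1 <= N)%N then phi n else interp R (pattern n') (extend N phi n')
  else phi 0%N.

Lemma extend_low N phi n : (n <= N)%N -> extend N phi n = phi n.
Proof. by case: n => //= n ->. Qed.

Lemma extend_high N phi n : (N <= n)%N ->
  extend N phi n.+1 = interp R (pattern n) (extend N phi n).
Proof. by move=> h /=; rewrite ltnNge h. Qed.

Lemma extend_first N phi n : (N <= n)%N -> extend N phi n 0 = phi N 0%N.
Proof.
move=> /subnKC <-; elim: (n - N)%N => [|k IH]; first by rewrite addn0 extend_low.
by rewrite addnS extend_high ?leq_addr // interp0.
Qed.

Lemma extend_last N phi n : (N <= n)%N ->
  extend N phi n (size (pattern n)) = phi N (size (pattern N)).
Proof.
move=> /subnKC <-; elim: (n - N)%N => [|k IH]; first by rewrite addn0 extend_low.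
by rewrite addnS extend_high ?leq_addr //= interp_last.
Qed.

Lemma dirichlet_extend N phi n : (N <= n)%N ->
  dirichlet R (pattern n) (extend N phi n) = rho ^+ (n - N) * dirichlet R (pattern N) (phi N).
Proof.
move=> /subnKC; move: (n - N)%N => k <-; elim: k => [|k IH].
  by rewrite addn0 extend_low // expr0 mul1r.
by rewrite addnS extend_high ?leq_addr // [pattern _.+1]/= dirichlet_interp IH mulrA -exprS.
Qed.

Lemma level_extend d N phi n (C : R) : 0 <= C -> (forall x z, d x x z <= C * (z - x) ^+ 2) ->
  (N <= n)%N ->
  level R d (extend N phi) n <= C * (rho ^+ (n - N).+1 * dirichlet R (pattern N) (phi N)).
Proof.
move=> C0 hd h; rewrite /level extend_high //.
by rewrite exprS -mulrA -(dirichlet_extend N phi n h) cellsum_interp.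
Qed.

(** The bound of [level_extend] shrinks by rho per level while the weight grows by 1 / r, so the
    tail is geometric with ratio rho / r < 1. *)
Lemma energy_extend d r N phi n (C : R) : rho < r -> 0 <= C ->
  (forall x y z, 0 <= d x y z) -> (forall x z, d x x z <= C * (z - x) ^+ 2) ->
  energy R d r (extend N phi) n <=
    energy R d r phi N + C * (rho * dirichlet R (pattern N) (phi N)) * r ^- N / (1 - rho / r).
Proof.
move=> rr C0 d0 hd; have rh0 := rho_gt0 R; have r0 : 0 < r by apply: lt_trans rr.
have q : 0 <= rho / r < 1 by rewrite divr_ge0 ?(ltW rh0) ?(ltW r0) //= ltr_pdivrMr // mul1r.
have D0 := dirichlet_ge0 R (pattern N) (phi N).
apply: le_trans (_ : energy R d r (extend N phi) (N + n) <= _).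
  exact/energy_mono/leq_addl.
rewrite /energy big_split_ord /=; apply: lerD.
  rewrite le_eqVlt; apply/orP; left; apply/eqP; apply: eq_bigr => i _.
  by rewrite /level !extend_low // ltnW.
apply: le_trans (_ : \sum_(i < n) C * (rho * dirichlet R (pattern N) (phi N)) * r ^- N * (rho / r) ^+ i <= _).
  apply: ler_sum => i _.
  have := level_extend d N phi (N + i) C C0 hd (leq_addr _ _); rewrite addKn => h.
  apply: le_trans (_ : r ^- (N + i) * (C * (rho ^+ i.+1 * dirichlet R (pattern N) (phi N))) <= _).
    by rewrite ler_wpM2l // invr_ge0 exprn_ge0 // ltW.
  rewrite le_eqVlt exprD exprS (expr_div_n rho r); apply/orP; left; apply/eqP.
  by field; rewrite !expf_neq0 // gt_eqF.
rewrite -mulr_sumr ler_wpM2l ?geometric_sum_le //.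
apply: mulr_ge0; last by rewrite invr_ge0 exprn_ge0 // ltW.
by apply: mulr_ge0 => //; apply: mulr_ge0 => //; exact: ltW.
Qed.

Lemma lipschitz_extend_first N phi : exists2 K : R, 0 <= K &
  forall n i, (N <= n)%N -> (i <= size (pattern n))%N ->
    `|extend N phi n i - phi N 0%N| <= K * pos R n i.
Proof.
have r0 := rho_gt0 R.
pose S := \sum_(i < (size (pattern N)).+1) `|phi N i - phi N 0%N|.
have S0 : 0 <= S by apply: sumr_ge0.
(* Distinct nodes of level [N] are at least rho^(N+2) apart, and [S] bounds every deviation on that
   level. *)
pose K := S / rho ^+ N.+2; have rN k : 0 < rho ^+ k by apply: exprn_gt0.
have K0 : 0 <= K by rewrite divr_ge0 // ltW.
exists K => // n i /subnKC; move: (n - N)%N => k <-; elim: k i => [|k IH] i.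
  rewrite addn0 extend_low // => hi; case: i hi => [|i] hi.
    by rewrite subrr normr0 mulr_ge0 // pos_ge0.
  apply: le_trans (_ : S <= _).
    by rewrite /S (bigD1 (inord i.+1)) //= inordK // lerDl sumr_ge0.
  rewrite /K mulrAC ler_pdivlMr // ler_wpM2l // /pos [X in X <= _]exprSr ler_wpM2l ?(ltW (rN _)) //.
  by have := offset_ltS R (pattern N) 0 i.+1 isT; rewrite offset0 add0r.
rewrite addnS extend_high ?leq_addr // => hi.
apply: le_trans (interp_lip_first (pattern (N + k)) _ _ (K * rho ^+ (N + k).+1) 0 _ _ i hi) _.
- by rewrite mulr_ge0 // ltW.
- by move=> j hj; rewrite add0r -mulrA; apply: IH.
by rewrite add0r /pos (exprSr rho (N + k).+1) !mulrA.
Qed.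

Lemma lipschitz_extend_last N phi : exists2 K : R, 0 <= K &
  forall n i, (N <= n)%N -> (i <= size (pattern n))%N ->
    `|reflect R (extend N phi) n i - phi N (size (pattern N))| <= K * pos R n i.
Proof.
have r0 := rho_gt0 R; set w := phi N _.
pose S := \sum_(i < (size (pattern N)).+1) `|phi N i - w|.
have S0 : 0 <= S by apply: sumr_ge0.
pose K := S / rho ^+ N.+2; have rN k : 0 < rho ^+ k by apply: exprn_gt0.
have K0 : 0 <= K by rewrite divr_ge0 // ltW.
suff H n i : (N <= n)%N -> (i <= size (pattern n))%N ->
    `|extend N phi n i - w| <= K * (pos R n (size (pattern n)) - pos R n i).
  exists K => // n i Nn hi; rewrite /reflect; apply: le_trans (H n _ Nn (leq_subr _ _)) _.
  by rewrite pos_rev // pos_last opprB addrC subrK.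
move=> /subnKC; move: (n - N)%N => k <-; elim: k i => [|k IH] i.
  rewrite addn0 extend_low //; rewrite leq_eqVlt => /orP[/eqP->|hi].
    by rewrite !subrr normr0 mulr0.
  apply: le_trans (_ : S <= _).
    by rewrite /S (bigD1 (inord i)) //= inordK ?lerDl ?sumr_ge0 // ltnS ltnW.
  rewrite /K mulrAC ler_pdivlMr // ler_wpM2l // /pos [X in X <= _]exprSr -mulrBr.
  rewrite ler_wpM2l ?(ltW (rN _)) //.
  by have := offset_ltS R (pattern N) _ _ hi; lra.
rewrite addnS extend_high ?leq_addr // => hi.
apply: le_trans (interp_lip_last (pattern (N + k)) _ w (K * rho ^+ (N + k).+1)
  (offset R (pattern (N + k)) (size (pattern (N + k)))) _ _ _ i hi) _.
- by rewrite mulr_ge0 // ltW.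
- exact/extend_last/leq_addr.
- by move=> j hj; rewrite -mulrA mulrBr; apply: IH.
rewrite /pos size_refine offset_childS // (exprSr rho (N + k).+1).
set a := offset _ _ _; set b := offset _ _ _; set y := rho ^+ _.
have e : rho * ((1 + rho) * a + 1) = a + rho.
  by transitivity ((rho + rho * rho) * a + rho); [ring|rewrite rho_sqr; ring].
by rewrite -e le_eqVlt; apply/orP; left; apply/eqP; ring.
Qed.

Lemma corner_extend_first N phi : corner (extend N phi) (phi N 0%N).
Proof. by have [K _ /corner_lipschitz] := lipschitz_extend_first N phi. Qed.

Lemma corner_extend_last N phi :
  corner (reflect R (extend N phi)) (phi N (size (pattern N))).
Proof. by have [K _ /corner_lipschitz] := lipschitz_extend_last N phi. Qed.

End Extension.

(** * Traces on the three corners *)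

Section Trace.
Variable R : realType.
Local Notation rho := (rho R).
Implicit Types (phi psi : nat -> nat -> R) (k r t M : R).

Definition boundary phi y z :=
  [/\ phi 0%N 0%N = 0, corner R phi y & corner R (reflect R phi) z].

Lemma boundary_lin phi psi y z y' z' a b : boundary phi y z -> boundary psi y' z' ->
  boundary (fun n i => a * phi n i + b * psi n i) (a * y + b * y') (a * z + b * z').
Proof.
move=> [h1 h2 h3] [g1 g2 g3]; split; first by rewrite h1 g1 !mulr0 addr0.
  exact: corner_lin.
exact: (corner_lin R (reflect R phi) (reflect R psi)).
Qed.

Lemma boundary_scale phi y z a : boundary phi y z ->
  boundary (fun n i => a * phi n i) (a * y) (a * z).
Proof.
move=> h; have := boundary_lin phi phi y z y z a 0 h h; rewrite !mul0r !addr0.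
have -> // : (fun n i => a * phi n i + 0 * phi n i) = (fun n i => a * phi n i).
by apply/funext => n; apply/funext => i; rewrite mul0r addr0.
Qed.

Lemma boundary_reflect phi y z : boundary phi y z -> boundary (reflect R phi) z y.
Proof.
move=> [h1 h2 h3]; split => //.
by apply: eq_corner h2 => n i hi; rewrite reflectK.
Qed.

Definition energy_le t r phi M := forall n, energy R (cell_form R t) r phi n <= M.

Lemma energy_lin t r phi psi a b n :
  energy R (cell_form R t) r (fun n i => a * phi n i + b * psi n i) n
  + energy R (cell_form R t) r (fun n i => a * phi n i - b * psi n i) n
  = 2 * a ^+ 2 * energy R (cell_form R t) r phi n + 2 * b ^+ 2 * energy R (cell_form R t) r psi n.
Proof.
rewrite /energy !mulr_sumr -!big_split /=; apply: eq_bigr => m _.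
rewrite /level /cellsum !mulr_sumr -!big_split /=; apply: eq_bigr => i _.
by rewrite /cell_form; ring.
Qed.

Lemma energy_scale t r phi a n :
  energy R (cell_form R t) r (fun n i => a * phi n i) n = a ^+ 2 * energy R (cell_form R t) r phi n.
Proof.
rewrite /energy !mulr_sumr; apply: eq_bigr => m _.
rewrite /level /cellsum !mulr_sumr; apply: eq_bigr => i _.
by rewrite /cell_form; ring.
Qed.

Lemma energy_reflect t r phi n :
  energy R (cell_form R t) r (reflect R phi) n = energy R (cell_form R t) r phi n.
Proof.
by apply: eq_bigr => m _; rewrite level_reflect // => x y z; rewrite cell_form_swap.
Qed.

Lemma energy_form_ge0 t r phi n : 0 < r -> 0 <= t -> 0 <= energy R (cell_form R t) r phi n.
Proof. by move=> r0 t0; apply: energy_ge0 => // x y z; apply: cell_form_ge0. Qed.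

Lemma energy_form_mono t r phi n m : 0 < r -> 0 <= t -> (n <= m)%N ->
  energy R (cell_form R t) r phi n <= energy R (cell_form R t) r phi m.
Proof. by move=> r0 t0; apply: energy_mono => // x y z; apply: cell_form_ge0. Qed.

Lemma cell_form_degenerate t x z : cell_form R t x x z <= (1 + t) / 2 * (z - x) ^+ 2.
Proof. by rewrite le_eqVlt; apply/orP; left; apply/eqP; rewrite /cell_form; field. Qed.

Definition seed (y z : R) n i : R := if n is 0%N then 0 else if i is 0%N then y else z.

Lemma boundary_seed y z : boundary (extend R 1 (seed y z)) y z.
Proof.
split => //; first exact: (corner_extend_first R 1 (seed y z)).
exact: (corner_extend_last R 1 (seed y z)).
Qed.

Lemma energy_le_seed t r y z : rho < r -> 0 <= t ->
  exists M, energy_le t r (extend R 1 (seed y z)) M.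
Proof.
move=> hr t0; eexists => n; apply: energy_extend hr _ _ (cell_form_degenerate t).
  by rewrite divr_ge0 // addr_ge0.
by move=> *; apply: cell_form_ge0.
Qed.

(* The header's A is the case k = -1 and G the case k = 1; functions vanish at q_0. *)
Definition trace_set k r t : set R :=
  [set M | exists2 phi, boundary phi (-1) k & energy_le t r phi (2 * M)].

(** At the data (-1, k) one of s and tau equals 2 and the other vanishes; the 2 in [trace_set] makes
    this number the coefficient of s or tau in the renormalized form. *)
Definition trace k r t : R := inf (trace_set k r t).

Lemma trace_set_lbound k r t : 0 < r -> 0 <= t -> lbound (trace_set k r t) 0.
Proof.
move=> r0 t0 M [phi _ /(_ 0%N)]; rewrite {1}/energy big_ord0; lra.
Qed.

Lemma trace_set_inf k r t : rho < r -> 0 <= t -> has_inf (trace_set k r t).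
Proof.
move=> hr t0; have r0 : 0 < r by apply: lt_trans hr; apply: rho_gt0.
split; last by exists 0; apply: trace_set_lbound.
have [M hM] := energy_le_seed t r (-1) k hr t0.
exists (M / 2), (extend R 1 (seed (-1) k)); first exact: boundary_seed.
by move=> n; rewrite mulrC divfK.
Qed.

Lemma trace_ge0 k r t : rho < r -> 0 <= t -> 0 <= trace k r t.
Proof.
move=> hr t0; have r0 : 0 < r by apply: lt_trans hr; apply: rho_gt0.
by apply: lb_le_inf; [case: (trace_set_inf k r t hr t0)|apply: trace_set_lbound].
Qed.

Lemma trace_le k r t phi M : rho < r -> 0 <= t -> boundary phi (-1) k ->
  energy_le t r phi (2 * M) -> trace k r t <= M.
Proof.
move=> hr t0 hb he; apply: ge_inf; first by case: (trace_set_inf k r t hr t0).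
by exists phi.
Qed.

Lemma trace_lb k r t x : rho < r -> 0 <= t ->
  (forall phi M, boundary phi (-1) k -> energy_le t r phi (2 * M) -> x <= M) -> x <= trace k r t.
Proof.
move=> hr t0 H; apply: lb_le_inf; first by case: (trace_set_inf k r t hr t0).
by move=> M [phi]; apply: H.
Qed.

Lemma trace_approx k r t M : rho < r -> 0 <= t -> trace k r t < M ->
  exists2 phi, boundary phi (-1) k & energy_le t r phi (2 * M).
Proof.
move=> hr t0 h; have [M' [phi hb he] hM] := inf_lt (proj1 (trace_set_inf k r t hr t0)) h.
by exists phi => // n; apply: le_trans (he n) _; lra.
Qed.

(** Averaging a near-minimizer with its mirror image, taken with sign -k, keeps the boundary data
    and by the parallelogram law [energy_lin] does not raise the energy. The result is even for k =
    -1 and odd for k = 1. *)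
Lemma trace_approx_sym k r t M : k * k = 1 -> rho < r -> 0 <= t -> trace k r t < M ->
  exists phi, [/\ boundary phi (-1) k, energy_le t r phi (2 * M) &
    forall n i, (i <= size (pattern n))%N -> reflect R phi n i = - k * phi n i].
Proof.
move=> kk hr t0 h; have r0 : 0 < r by apply: lt_trans hr; apply: rho_gt0.
have [phi hb he] := trace_approx k r t M hr t0 h.
exists (fun n i => 2^-1 * phi n i + - (k / 2) * reflect R phi n i); split.
- have := boundary_lin _ _ _ _ _ _ (2^-1) (- (k / 2)) hb (boundary_reflect _ _ _ hb).
  have -> : 2^-1 * -1 + - (k / 2) * k = -1 by transitivity (- 2^-1 - k * k / 2); [ring|rewrite kk; field].
  by have -> : 2^-1 * k + - (k / 2) * -1 = k by field.
- move=> n; have := energy_lin t r phi (reflect R phi) (2^-1) (- (k / 2)) n.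
  have := energy_form_ge0 t r (fun n i => 2^-1 * phi n i - - (k / 2) * reflect R phi n i) n r0 t0.
  rewrite energy_reflect.
  have -> : (- (k / 2)) ^+ 2 = 4^-1 by transitivity (k * k / 4); [field|rewrite kk; field].
  by have := he n; lra.
move=> n i hi; rewrite {1}/reflect -/(reflect R phi n i) /reflect subKn //.
rewrite -/(reflect R phi n i).
transitivity (2^-1 * reflect R phi n i - k / 2 * phi n i); first by ring.
by transitivity (- k / 2 * phi n i + (k * k) / 2 * reflect R phi n i); [rewrite kk; ring|field].
Qed.

Lemma trace_scale k r t phi x M : rho < r -> 0 <= t ->
  boundary phi (x * -1) (x * k) -> energy_le t r phi M -> 2 * x ^+ 2 * trace k r t <= M.
Proof.
move=> hr t0 hb he; have r0 : 0 < r by apply: lt_trans hr; apply: rho_gt0.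
have M0 : 0 <= M by apply: le_trans (he 0%N); apply: energy_form_ge0.
have [->|x0] := eqVneq x 0; first by rewrite expr0n /= mulr0 mul0r.
have h : trace k r t <= M / (2 * x ^+ 2).
  apply: (trace_le k r t (fun n i => x^-1 * phi n i)) => //.
    by have := boundary_scale _ _ _ x^-1 hb; rewrite !mulKf.
  move=> n; rewrite energy_scale; apply: le_trans (_ : x^-1 ^+ 2 * M <= _).
    by rewrite ler_wpM2l // sqr_ge0.
  by rewrite le_eqVlt; apply/orP; left; apply/eqP; field.
have x2 : 0 < 2 * x ^+ 2 by rewrite mulr_gt0 // exprn_even_gt0.
by move: h; rewrite ler_pdivlMr // mulrC.
Qed.

(* The reflection splits a function orthogonally into its even and odd parts, so the
   trace has no cross term between the two. *)
Lemma trace_form_lower r t phi y z M : rho < r -> 0 <= t -> boundary phi y z ->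
  energy_le t r phi M ->
  2 * ((y + z) / 2) ^+ 2 * trace (-1) r t + 2 * ((z - y) / 2) ^+ 2 * trace 1 r t <= M.
Proof.
move=> hr t0 hb he; have r0 : 0 < r by apply: lt_trans hr; apply: rho_gt0.
have hbr := boundary_reflect _ _ _ hb.
set f1 := fun n i => 2^-1 * phi n i + 2^-1 * reflect R phi n i.
set f2 := fun n i => 2^-1 * phi n i - 2^-1 * reflect R phi n i.
have b1 : boundary f1 (- ((y + z) / 2) * -1) (- ((y + z) / 2) * -1).
  have := boundary_lin _ _ _ _ _ _ (2^-1) (2^-1) hb hbr.
  have -> : 2^-1 * y + 2^-1 * z = - ((y + z) / 2) * -1 by field.
  by have -> : 2^-1 * z + 2^-1 * y = - ((y + z) / 2) * -1 by field.
have b2 : boundary f2 ((z - y) / 2 * -1) ((z - y) / 2 * 1).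
  have := boundary_lin _ _ _ _ _ _ (2^-1) (- 2^-1) hb hbr.
  have -> : 2^-1 * y + - 2^-1 * z = (z - y) / 2 * -1 by field.
  have -> : 2^-1 * z + - 2^-1 * y = (z - y) / 2 * 1 by field.
  suff -> : (fun n i => 2^-1 * phi n i + - 2^-1 * reflect R phi n i) = f2 by [].
  by apply/funext => n; apply/funext => i; rewrite /f2; ring.
have H n m : energy R (cell_form R t) r f1 n + energy R (cell_form R t) r f2 m <= M.
  have m1 := energy_form_mono t r f1 _ _ r0 t0 (leq_maxl n m).
  have m2 := energy_form_mono t r f2 _ _ r0 t0 (leq_maxr n m).
  have := energy_lin t r phi (reflect R phi) (2^-1) (2^-1) (maxn n m).
  rewrite -/f1 -/f2 energy_reflect; have := he (maxn n m).
  by rewrite expr2; lra.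
have H1 m : 2 * ((y + z) / 2) ^+ 2 * trace (-1) r t <= M - energy R (cell_form R t) r f2 m.
  rewrite -(sqrrN ((y + z) / 2)); apply: (trace_scale _ _ _ f1) => // n.
  by have := H n m; lra.
suff : 2 * ((z - y) / 2) ^+ 2 * trace 1 r t <= M - 2 * ((y + z) / 2) ^+ 2 * trace (-1) r t by lra.
by apply: (trace_scale _ _ _ f2) => // m; have := H1 m; lra.
Qed.

(** Near-minimizers of the two parts are combined linearly. Their cross term disappears on averaging
    with the mirror image of the combination of opposite sign, which has the same boundary
    values. *)
Lemma trace_form_upper r t y z e : rho < r -> 0 <= t -> 0 < e ->
  exists2 phi, boundary phi y z & energy_le t r phi
  (2 * ((y + z) / 2) ^+ 2 * trace (-1) r t + 2 * ((z - y) / 2) ^+ 2 * trace 1 r t + e).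
Proof.
move=> hr t0 e0; have r0 : 0 < r by apply: lt_trans hr; apply: rho_gt0.
set x := (y + z) / 2; set w := (z - y) / 2.
pose c := e / (2 * x ^+ 2 + 2 * w ^+ 2 + 1).
have x0 := sqr_ge0 x; have w0 := sqr_ge0 w.
have D0 : 0 < 2 * x ^+ 2 + 2 * w ^+ 2 + 1 by lra.
have c0 : 0 < c by rewrite divr_gt0.
have ce : c * (2 * x ^+ 2 + 2 * w ^+ 2 + 1) = e by rewrite /c divfK // gt_eqF.
have [f hf1 hf2] : exists2 phi, boundary phi (-1) (-1) & energy_le t r phi (2 * (trace (-1) r t + c)).
  by apply: trace_approx => //; lra.
have [g hg1 hg2] : exists2 phi, boundary phi (-1) 1 & energy_le t r phi (2 * (trace 1 r t + c)).
  by apply: trace_approx => //; lra.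
pose p1 n i := - x * f n i + w * g n i.
pose p2 n i := - x * f n i - w * g n i.
have q1 : boundary p1 y z.
  have := boundary_lin _ _ _ _ _ _ (- x) w hf1 hg1.
  have -> : - x * -1 + w * -1 = y by rewrite /x /w; field.
  by have -> : - x * -1 + w * 1 = z by rewrite /x /w; field.
have q2 : boundary (reflect R p2) y z.
  apply: boundary_reflect; have := boundary_lin _ _ _ _ _ _ (- x) (- w) hf1 hg1.
  have -> : - x * -1 + - w * -1 = z by rewrite /x /w; field.
  have -> : - x * -1 + - w * 1 = y by rewrite /x /w; field.
  suff -> : (fun n i => - x * f n i + - w * g n i) = p2 by [].
  by apply/funext => n; apply/funext => i; rewrite /p2; ring.
exists (fun n i => 2^-1 * p1 n i + 2^-1 * reflect R p2 n i).
  have := boundary_lin _ _ _ _ _ _ (2^-1) (2^-1) q1 q2.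
  have -> : 2^-1 * y + 2^-1 * y = y by field.
  by have -> : 2^-1 * z + 2^-1 * z = z by field.
move=> n; have := energy_lin t r p1 (reflect R p2) (2^-1) (2^-1) n.
have := energy_form_ge0 t r (fun n i => 2^-1 * p1 n i - 2^-1 * reflect R p2 n i) n r0 t0.
rewrite energy_reflect; have := energy_lin t r f g (- x) w n; rewrite -/p1 -/p2 sqrrN.
have : x ^+ 2 * energy R (cell_form R t) r f n <= x ^+ 2 * (2 * (trace (-1) r t + c)).
  by rewrite ler_wpM2l.
have : w ^+ 2 * energy R (cell_form R t) r g n <= w ^+ 2 * (2 * (trace 1 r t + c)).
  by rewrite ler_wpM2l.
rewrite (expr2 2^-1); lra.
Qed.

(** * Dependence of the traces on t and r *)

Lemma energy_le_form t t' r phi n : 0 < r -> t <= t' ->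
  energy R (cell_form R t) r phi n <= energy R (cell_form R t') r phi n.
Proof.
move=> r0 tt; apply: ler_sum => m _; rewrite ler_wpM2l ?invr_ge0 ?exprn_ge0 ?(ltW r0) //.
apply: ler_cellsum => x y z; rewrite /cell_form lerD2l; apply: ler_wpM2r => //.
by have := sqr_ge0 (y - z); lra.
Qed.

Lemma energy_le_ratio t t' r phi n : 0 < r -> 0 < t -> t <= t' ->
  energy R (cell_form R t') r phi n <= t' / t * energy R (cell_form R t) r phi n.
Proof.
move=> r0 t0 tt; rewrite /energy mulr_sumr; apply: ler_sum => m _.
rewrite mulrCA ler_wpM2l ?invr_ge0 ?exprn_ge0 ?(ltW r0) // /level -cellsumZ.
apply: ler_cellsum => x y z; rewrite /cell_form mulrDr (mulrA (t' / t) t) divfK ?gt_eqF // lerD2r.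
apply: ler_peMl; first by have := sqr_ge0 (2 * x - y - z); lra.
by rewrite ler_pdivlMr ?mul1r.
Qed.

Lemma trace_mono_t k r t t' : rho < r -> 0 <= t -> t <= t' -> trace k r t <= trace k r t'.
Proof.
move=> hr t0 tt; have r0 : 0 < r by apply: lt_trans hr; apply: rho_gt0.
apply: trace_lb => //; first by apply: le_trans tt.
move=> phi M hb he; apply: (trace_le _ _ _ phi) => // n.
exact: le_trans (energy_le_form _ _ _ _ _ r0 tt) (he n).
Qed.

Lemma trace_ratio_t k r t t' : rho < r -> 0 < t -> t <= t' ->
  t * trace k r t' <= t' * trace k r t.
Proof.
move=> hr t0 tt; have r0 : 0 < r by apply: lt_trans hr; apply: rho_gt0.
have t'0 : 0 < t' by apply: lt_le_trans tt.
suff : t / t' * trace k r t' <= trace k r t.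
  by rewrite mulrAC ler_pdivrMr // mulrC [trace k r t * _]mulrC mulrC.
apply: trace_lb => //; first exact: ltW.
move=> phi M hb he; rewrite mulrAC ler_pdivrMr // mulrC -ler_pdivlMr //.
apply: (trace_le _ _ _ phi) => //; first exact: ltW.
move=> n; apply: le_trans (energy_le_ratio t t' _ _ _ r0 t0 tt) _.
apply: le_trans (_ : t' / t * (2 * M) <= _).
  by rewrite ler_wpM2l ?he // divr_ge0 // ltW.
by rewrite le_eqVlt; apply/orP; left; apply/eqP; field; rewrite gt_eqF.
Qed.

Lemma energy_mono_r t r r' phi n : 0 < r -> r <= r' -> 0 <= t ->
  energy R (cell_form R t) r' phi n <= energy R (cell_form R t) r phi n.
Proof.
move=> r0 rr t0; apply: ler_sum => m _; apply: ler_wpM2r.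
  by apply: cellsum_ge0 => *; apply: cell_form_ge0.
have r'0 : 0 < r' by apply: lt_le_trans rr.
by rewrite lef_pV2 ?posrE ?exprn_gt0 // lerXn2r // nnegrE ltW.
Qed.

Lemma trace_mono_r k r r' t : rho < r -> r <= r' -> 0 <= t -> trace k r' t <= trace k r t.
Proof.
move=> hr rr t0; have r0 : 0 < r by apply: lt_trans hr; apply: rho_gt0.
apply: trace_lb => // phi M hb he; apply: (trace_le _ _ _ phi) => //.
  exact: lt_le_trans rr.
by move=> n; apply: le_trans (energy_mono_r _ _ _ _ _ r0 rr t0) (he n).
Qed.

End Trace.

(** * Bounds for the traces *)

Section Bounds.
Variable R : realType.
Local Notation rho := (rho R).
Implicit Types (phi psi : nat -> nat -> R) (k r t M : R).

(* Resistances in series: [C] and [c] are resistances, [S] and [d ^+ 2 / c] energies. *)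
Lemma series_step (x d C S c : R) : 0 <= C -> 0 <= S -> 0 < c -> x ^+ 2 <= C * S ->
  (x + d) ^+ 2 <= (C + c) * (S + d ^+ 2 / c).
Proof.
move=> C0 S0 c0 h.
have -> : (C + c) * (S + d ^+ 2 / c) = C * S + (C * (d ^+ 2 / c) + c * S) + d ^+ 2.
  by field; rewrite gt_eqF.
set u := C * (d ^+ 2 / c); set w := c * S.
have u0 : 0 <= u by rewrite mulr_ge0 // divr_ge0 ?sqr_ge0 // ltW.
have w0 : 0 <= w by rewrite mulr_ge0 // ltW.
have uw : (x * d) ^+ 2 <= u * w.
  have -> : u * w = C * S * d ^+ 2 by rewrite /u /w; field; rewrite gt_eqF.
  by rewrite exprMn ler_wpM2r // sqr_ge0.
suff : 2 * (x * d) <= u + w by nra.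
have [xd|xd] := lerP (x * d) 0; first by lra.
have := sqr_ge0 (u - w); rewrite leNgt => h1; rewrite leNgt; apply/negP => h2; nra.
Qed.

(** * Resistance along the sides *)

Definition chain_energy r phi N n : R :=
  \sum_(m < n) r ^- (N + m) * (phi (N + m)%N 0%N - phi (N + m).+1 0%N) ^+ 2.

Lemma chain_energy_ge0 r phi N n : 0 < r -> 0 <= chain_energy r phi N n.
Proof.
by move=> r0; apply: sumr_ge0 => m _; rewrite mulr_ge0 ?sqr_ge0 // invr_ge0 exprn_ge0 // ltW.
Qed.

(** The edges along the left side from level [N] to q_1 are resistances r^m in series, of total r^N
    / (1 - r). *)
Lemma chain_bound r phi u N M : 0 < r < 1 -> corner R phi u ->
  (forall n, chain_energy r phi N n <= M) ->
  (phi N 0%N - u) ^+ 2 <= r ^+ N / (1 - r) * M.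
Proof.
move=> /andP[r0 r1] hc hM; have s0 : 0 < 1 - r by lra.
have rN := exprn_gt0 N r0.
have B n : (phi N 0%N - phi (N + n)%N 0%N) ^+ 2 <= r ^+ N / (1 - r) * M.
  have H : (phi N 0%N - phi (N + n)%N 0%N) ^+ 2 <=
      (\sum_(m < n) r ^+ (N + m)) * chain_energy r phi N n.
    elim: n => [|n IH]; first by rewrite addn0 subrr expr0n /= big_ord0 mul0r.
    rewrite /chain_energy !big_ord_recr /= -/(chain_energy r phi N n) addnS.
    have := series_step _ (phi (N + n)%N 0%N - phi (N + n).+1 0%N) _ _ (r ^+ (N + n)) _ _ _ IH.
    rewrite addrA subrK [_ / r ^+ (N + n)]mulrC; apply.
    - by apply: sumr_ge0 => m _; rewrite exprn_ge0 // ltW.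
    - exact: chain_energy_ge0.
    - by rewrite exprn_gt0.
  apply: le_trans H _; apply: ler_pM => //.
  - by apply: sumr_ge0 => m _; rewrite exprn_ge0 // ltW.
  - exact: chain_energy_ge0.
  under eq_bigr do rewrite exprD; rewrite -mulr_sumr.
  apply: ler_wpM2l; first exact: ltW.
  by apply: geometric_sum_le; rewrite ltW.
set K := r ^+ N / (1 - r) * M in B *.
have K0 : 0 <= K by apply: le_trans (B 0%N); rewrite sqr_ge0.
rewrite leNgt; apply/negP => h; set x := phi N 0%N - u in h.
have x0 : 0 < `|x| by rewrite normr_gt0; apply/eqP => e; move: h; rewrite e expr0n /=; lra.
(* With e this number, x^2 - 2 |x| e = K: a value within e of [u] is still too far from
   [phi N 0]. *)
have e0 : 0 < (x ^+ 2 - K) / (2 * `|x|) by rewrite divr_gt0 ?mulr_gt0 // subr_gt0.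
have [n0 hn0] := corner_first R phi u hc _ e0.
have := B n0; have := hn0 (N + n0)%N (leq_addl _ _).
set y := phi (N + n0)%N 0%N; rewrite ltr_pdivlMr ?mulr_gt0 //.
have -> : phi N 0%N - y = x - (y - u) by rewrite /x; ring.
have := ler_norm (x * (y - u)); rewrite normrM => h1 h2 h3.
have := sqr_ge0 (y - u); have : (x - (y - u)) ^+ 2 = x ^+ 2 - 2 * (x * (y - u)) + (y - u) ^+ 2 by ring.
by lra.
Qed.

(** Keeps the outer edge of the first and of the last cell; on level 0 these are the two edges of
    the single cell. *)
Lemma level_ge_ends t phi n : 1 <= t ->
  (phi n 0%N - phi n.+1 0%N) ^+ 2 + (reflect R phi n 0%N - reflect R phi n.+1 0%N) ^+ 2
  <= level R (cell_form R t) phi n.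
Proof.
move=> t1; have H x y z := cell_form_ge R t x y z t1.
have P x y z : 0 <= cell_form R t x y z by apply: cell_form_ge0; lra.
rewrite /level /cellsum /reflect !subn0 [pattern n.+1]/= size_refine.
case: (pattern n) => [|b p].
  by rewrite big_ord_recl big_ord0 addr0 child0; exact: H.
rewrite big_ord_recl big_ord_recr /= child0 addrCA addrA addrAC.
rewrite /bump /= add1n; set s := \sum_(i < _) _.
have : 0 <= s by apply: sumr_ge0.
have := H (phi n 0%N) (phi n.+1 0%N) (phi n.+1 1%N).
have := H (phi n (size p).+1) (phi n.+1 (child (b :: p) (size p).+1)) (phi n.+1 (child (b :: p) (size p).+1).+1).
have := sqr_ge0 (phi n 0%N - phi n.+1 1%N).
have := sqr_ge0 (phi n (size p).+1 - phi n.+1 (child (b :: p) (size p).+1)).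
lra.
Qed.

Lemma chain_energy_le t r phi N n : 1 <= t -> 0 < r ->
  chain_energy r phi N n + chain_energy r (reflect R phi) N n
  <= energy R (cell_form R t) r phi (N + n).
Proof.
move=> t1 r0; rewrite -big_split /= /energy big_split_ord /=.
rewrite -[leLHS]add0r; apply: lerD.
  by apply: energy_form_ge0 => //; lra.
apply: ler_sum => m _; rewrite -mulrDr ler_wpM2l ?level_ge_ends //.
by rewrite invr_ge0 exprn_ge0 // ltW.
Qed.

Lemma corner_energy_bound t r phi u N M : 1 <= t -> 0 < r < 1 ->
  corner R phi u -> energy_le R t r phi M -> (phi N 0%N - u) ^+ 2 <= r ^+ N / (1 - r) * M.
Proof.
move=> t1 r01 hc he; apply: chain_bound => // n; have /andP[r0 _] := r01.
apply: le_trans (he (N + n)%N); apply: le_trans (chain_energy_le t r phi N n t1 r0).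
by rewrite lerDl chain_energy_ge0.
Qed.


Lemma trace_gt0 k r t : rho < r < 1 -> 1 <= t -> 0 < trace R k r t.
Proof.
move=> /andP[hr r1] t1; have r0 : 0 < r by apply: lt_trans hr; apply: rho_gt0.
have s0 : 0 < 1 - r by lra.
apply: lt_le_trans (_ : (1 - r) / 2 <= _); first by lra.
apply: trace_lb => //; first by lra.
move=> phi M [h0 h1 _] he; have := corner_energy_bound t r phi (-1) 0 _ t1 _ h1 he.
rewrite r0 r1 h0 expr0 => /(_ isT); rewrite mulrAC ler_pdivlMr //; lra.
Qed.

(* The path 1, 12, 121, 1211 = 1122, 112, 11 in parallel to the edge from 1 to 11. *)
Definition detour r phi : R :=
  (phi 1%N 0%N - phi 2%N 1%N) ^+ 2 / r + (phi 2%N 1%N - phi 3%N 2%N) ^+ 2 / r ^+ 2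
  + (phi 2%N 0%N - phi 3%N 1%N) ^+ 2 / r ^+ 2
  + ((phi 3%N 1%N - phi 4%N 3%N) ^+ 2 + (phi 3%N 2%N - phi 4%N 3%N) ^+ 2) / r ^+ 3.

(** This and the next three lemmas keep the edges of the left side, of its detour and of their
    mirror images, and drop the other terms of levels 0 to 3. *)
Lemma level0_ge phi : (phi 0%N 0%N - phi 1%N 0%N) ^+ 2 + (phi 0%N 0%N - phi 1%N 1%N) ^+ 2
  <= level R (cell_form R 1) phi 0.
Proof.
by rewrite /level /cellsum big_ord_recl big_ord0 addr0 child0; apply: cell_form_ge.
Qed.

Lemma level1_ge phi : (phi 1%N 0%N - phi 2%N 0%N) ^+ 2 + (phi 1%N 0%N - phi 2%N 1%N) ^+ 2
  + ((phi 1%N 1%N - phi 2%N 3%N) ^+ 2 + (phi 1%N 1%N - phi 2%N 2%N) ^+ 2)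
  <= level R (cell_form R 1) phi 1.
Proof.
rewrite /level /cellsum !big_ord_recl big_ord0 addr0 /child /=.
apply: lerD; first by apply: cell_form_ge.
by rewrite addrC; apply: cell_form_ge.
Qed.

Lemma level2_ge phi :
  (phi 2%N 0%N - phi 3%N 0%N) ^+ 2 + (phi 2%N 0%N - phi 3%N 1%N) ^+ 2
  + (phi 2%N 1%N - phi 3%N 2%N) ^+ 2
  + ((phi 2%N 3%N - phi 3%N 6%N) ^+ 2 + (phi 2%N 3%N - phi 3%N 5%N) ^+ 2
  + (phi 2%N 2%N - phi 3%N 4%N) ^+ 2)
  <= level R (cell_form R 1) phi 2.
Proof.
rewrite /level /cellsum !big_ord_recl big_ord0 addr0 /child /=.
have := cell_form_ge R 1 (phi 2%N 0%N) (phi 3%N 0%N) (phi 3%N 1%N) (lexx _).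
have := cell_form_ge R 1 (phi 2%N 1%N) (phi 3%N 2%N) (phi 3%N 3%N) (lexx _).
have := cell_form_ge R 1 (phi 2%N 2%N) (phi 3%N 3%N) (phi 3%N 4%N) (lexx _).
have := cell_form_ge R 1 (phi 2%N 3%N) (phi 3%N 5%N) (phi 3%N 6%N) (lexx _).
have := sqr_ge0 (phi 2%N 1%N - phi 3%N 3%N); have := sqr_ge0 (phi 2%N 2%N - phi 3%N 3%N).
rewrite /bump /= !add1n; lra.
Qed.

Lemma level3_ge phi :
  (phi 3%N 0%N - phi 4%N 0%N) ^+ 2
  + ((phi 3%N 1%N - phi 4%N 3%N) ^+ 2 + (phi 3%N 2%N - phi 4%N 3%N) ^+ 2)
  + ((phi 3%N 6%N - phi 4%N 11%N) ^+ 2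
  + ((phi 3%N 5%N - phi 4%N 8%N) ^+ 2 + (phi 3%N 4%N - phi 4%N 8%N) ^+ 2))
  <= level R (cell_form R 1) phi 3.
Proof.
rewrite /level /cellsum !big_ord_recl big_ord0 addr0 /child /=.
have := cell_form_ge R 1 (phi 3%N 0%N) (phi 4%N 0%N) (phi 4%N 1%N) (lexx _).
have := cell_form_ge R 1 (phi 3%N 1%N) (phi 4%N 2%N) (phi 4%N 3%N) (lexx _).
have := cell_form_ge R 1 (phi 3%N 2%N) (phi 4%N 3%N) (phi 4%N 4%N) (lexx _).
have := cell_form_ge0 R 1 (phi 3%N 3%N) (phi 4%N 5%N) (phi 4%N 6%N) ler01.
have := cell_form_ge R 1 (phi 3%N 4%N) (phi 4%N 7%N) (phi 4%N 8%N) (lexx _).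
have := cell_form_ge R 1 (phi 3%N 5%N) (phi 4%N 8%N) (phi 4%N 9%N) (lexx _).
have := cell_form_ge R 1 (phi 3%N 6%N) (phi 4%N 10%N) (phi 4%N 11%N) (lexx _).
have := sqr_ge0 (phi 3%N 0%N - phi 4%N 1%N); have := sqr_ge0 (phi 3%N 1%N - phi 4%N 2%N).
have := sqr_ge0 (phi 3%N 2%N - phi 4%N 4%N); have := sqr_ge0 (phi 3%N 4%N - phi 4%N 7%N).
have := sqr_ge0 (phi 3%N 5%N - phi 4%N 9%N); have := sqr_ge0 (phi 3%N 6%N - phi 4%N 10%N).
rewrite /bump /= !add1n; lra.
Qed.

Definition side_energy r phi n : R :=
  (phi 0%N 0%N - phi 1%N 0%N) ^+ 2 + (phi 1%N 0%N - phi 2%N 0%N) ^+ 2 / r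
  + detour r phi + chain_energy r phi 2 n.

(** The two sides share no edge. The levels 0 to 3, present already for n = 0, contain both detours
    completely. *)
Lemma side_energy_le r phi n : 0 < r ->
  side_energy r phi n.+2 + side_energy r (reflect R phi) n.+2
  <= energy R (cell_form R 1) r phi (2 + n.+2).
Proof.
move=> r0; have rV m : 0 <= r ^- m by rewrite invr_ge0 exprn_ge0 // ltW.
elim: n => [|n IH].
  rewrite /side_energy /detour /chain_energy /energy !big_ord_recr !big_ord0 /=.
  rewrite /reflect /= !addn0 !add0r expr0 invr1 !mul1r.
  have h0 := level0_ge phi.
  have h1 := ler_wpM2l (rV 1%N) (level1_ge phi).
  have h2 := ler_wpM2l (rV 2%N) (level2_ge phi).
  have h3 := ler_wpM2l (rV 3%N) (level3_ge phi).
  by move: h1 h2 h3; rewrite expr1; lra.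
move: IH; rewrite /side_energy /chain_energy /energy ![\sum_(m < n.+3) _]big_ord_recr.
rewrite [\sum_(m < 2 + n.+3) _]big_ord_recr /= => IH.
have := ler_wpM2l (rV (2 + n.+2)%N) (level_ge_ends 1 phi (2 + n.+2) (lexx _)).
by rewrite mulrDr; move: IH; rewrite !addnS !addSn !add0n; lra.
Qed.

Lemma side_energy_sym k r phi n : k * k = 1 ->
  (forall n i, (i <= size (pattern n))%N -> reflect R phi n i = - k * phi n i) ->
  side_energy r (reflect R phi) n = side_energy r phi n.
Proof.
move=> kk h; have sq a b : (- k * a - - k * b) ^+ 2 = (a - b) ^+ 2.
  by transitivity (k * k * (a - b) ^+ 2); [ring|rewrite kk mul1r].
rewrite /side_energy /detour !h // !sq; congr (_ + _).
by apply: eq_bigr => m _; rewrite !h // sq.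
Qed.

(** By symmetry each side carries at most half of the energy. The bare side, of resistance 1 / (1 -
    r), would give only 1 - r = 3/8 < 25/64; the detour supplies the difference. The number 5/8 is a
    rational just above rho. *)
Lemma trace_start k : k * k = 1 -> (5 / 8) ^+ 2 <= trace R k (5 / 8) 1.
Proof.
set r : R := 5 / 8 => kk; have r0 : 0 < r by rewrite /r; lra.
have hr : rho < r by have := rho_bounds R; rewrite /r; lra.
rewrite leNgt; apply/negP => h.
have [phi [[h0 h1 _] he hs]] := trace_approx_sym R k r 1 _ kk hr ler01 h.
have S n : side_energy r phi n.+2 <= r ^+ 2.
  have := le_trans (side_energy_le r phi n r0) (he (2 + n.+2)%N).
  by rewrite (side_energy_sym k) //; lra.
set E := r ^+ 2 - ((phi 0%N 0%N - phi 1%N 0%N) ^+ 2 + (phi 1%N 0%N - phi 2%N 0%N) ^+ 2 / r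
  + detour r phi).
have C n : chain_energy r phi 2 n <= E.
  apply: le_trans (_ : chain_energy r phi 2 n.+2 <= E).
    rewrite /chain_energy !big_ord_recr /= -addrA lerDl addr_ge0 // mulr_ge0 ?sqr_ge0 //;
      by rewrite invr_ge0 exprn_ge0 // ltW.
  by have := S n; rewrite /side_energy /E; lra.
have r1 : 0 < r < 1 by rewrite r0 /r; lra.
have := chain_bound r phi (-1) 2 E r1 h1 C; rewrite /E /detour h0 /r.
have -> : (5 / 8 : R)^-1 = 8 / 5 by field.
have -> : ((5 / 8 : R) ^+ 2)^-1 = 64 / 25 by field.
have -> : ((5 / 8 : R) ^+ 3)^-1 = 512 / 125 by field.
have -> : (5 / 8 : R) ^+ 2 / (1 - 5 / 8) = 25 / 24 by field.
have -> : (5 / 8 : R) ^+ 2 = 25 / 64 by field.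
set a := phi 1%N 0%N; set b := phi 2%N 0%N; set y1 := phi 2%N 1%N.
set y2 := phi 3%N 2%N; set y3 := phi 4%N 3%N; set y4 := phi 3%N 1%N.
(* Thomson's principle: the squares compare the potential drops with a flow of strength
   2/5 along the chain, of which 1/10 takes the detour around the second edge. *)
have := sqr_ge0 (a + 2 / 5); have := sqr_ge0 ((a - b) * (8 / 5) - 3 / 10).
have := sqr_ge0 ((a - y1) * (8 / 5) - 1 / 10).
have := sqr_ge0 ((y1 - y2) * (64 / 25) - 1 / 10).
have := sqr_ge0 ((y2 - y3) * (512 / 125) - 1 / 10).
have := sqr_ge0 ((y3 - y4) * (512 / 125) - 1 / 10).
have := sqr_ge0 ((y4 - b) * (64 / 25) - 1 / 10).
have := sqr_ge0 ((b + 1) - 2 / 5 * (25 / 24)).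
lra.
Qed.

Lemma trace_symmetric_lt r t : 9 / 10 <= r < 1 -> 1 <= t -> trace R (-1) r t < r ^+ 2.
Proof.
move=> /andP[r9 r1] t1; have r0 : 0 < r by lra.
have hr : rho < r by have := rho_bounds R; lra.
(* Constant on each level, so tau vanishes and the bound does not depend on t. *)
pose phi n (i : nat) : R := match n with 0%N => 0 | 1%N => - (2 / 3) | _ => -1 end.
apply: le_lt_trans (_ : 4 / 9 + 2 / 9 / r < _).
  apply: (trace_le R _ _ _ phi) => //; first by lra.
    have c : corner R phi (-1).
      by apply: (corner_lipschitz R _ _ 0 2) => -[|[|n]] i //= _ _; rewrite subrr normr0 mul0r.
    by split.
  move=> n; apply: le_trans (_ : energy R (cell_form R t) r phi (2 + n) <= _).
    by apply: energy_form_mono => //; [lra|exact: leq_addl].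
  rewrite /energy big_split_ord /= [X in _ + X]big1 => [|m _]; last first.
    rewrite /level /cellsum big1 ?mulr0 // => i _; rewrite /cell_form /=; ring.
  rewrite !big_ord_recr big_ord0 /= addr0 add0r expr0 invr1 mul1r expr1.
  rewrite /level /cellsum !big_ord_recr !big_ord0 /= /cell_form /= !add0r.
  rewrite le_eqVlt; apply/orP; left; apply/eqP; field; rewrite gt_eqF //.
have : r^-1 <= 10 / 9 by rewrite -[leLHS]mul1r ler_pdivrMr //; lra.
by nra.
Qed.

(** The map x -> -|x| sends the data (-1, 1) to (-1, -1) and, at t = 1, contracts each of the two
    squares of the form. *)
Lemma trace_sym_le_antisym r : rho < r -> trace R (-1) r 1 <= trace R 1 r 1.
Proof.
move=> hr; have r0 : 0 < r by apply: lt_trans hr; apply: rho_gt0.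
apply: trace_lb => // phi M [h0 h1 h2] he.
pose psi n i := -1 * `|phi n i|.
have N x : `|x| = 1 -> (-1 : R) = -1 * `|x| by move=> ->; rewrite mulr1.
apply: (trace_le R _ _ _ psi) => //.
  split; first by rewrite /psi h0 normr0 mulr0.
    have := corner_lin R _ _ _ _ (-1) 0 (corner_norm R _ _ h1) h1.
    rewrite normrN1 mulr1 mul0r addr0; apply: eq_corner => n i _; by rewrite mul0r addr0.
  have := corner_lin R _ _ _ _ (-1) 0 (corner_norm R _ _ h2) h2.
  rewrite normr1 !mulr1 addr0; apply: eq_corner => n i _; by rewrite mul0r addr0.
move=> n; apply: le_trans (he n); apply: ler_sum => m _.
rewrite ler_wpM2l ?invr_ge0 ?exprn_ge0 ?(ltW r0) //; apply: ler_sum => i _.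
have E x y z : cell_form R 1 x y z = (x - y) ^+ 2 + (x - z) ^+ 2 by rewrite /cell_form; field.
have L (x y : R) : (-1 * `|x| - -1 * `|y|) ^+ 2 <= (x - y) ^+ 2.
  have -> : -1 * `|x| - -1 * `|y| = - (`|x| - `|y|) by ring.
  rewrite sqrrN -(real_normK (num_real (`|x| - `|y|))) -(real_normK (num_real (x - y))).
  by rewrite lerXn2r ?nnegrE // ler_dist_dist.
by rewrite !E lerD // L.
Qed.

Definition form_sym (x y z : R) : R := (2 * x - y - z) ^+ 2 / 2.
Definition form_anti (x y z : R) : R := (y - z) ^+ 2 / 2.

Lemma energy_split t r phi n : energy R (cell_form R t) r phi n =
  energy R form_sym r phi n + t * energy R form_anti r phi n.
Proof.
rewrite /energy mulr_sumr -big_split /=; apply: eq_bigr => m _.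
rewrite mulrCA -mulrDr; congr (_ * _).
by rewrite /level /cellsum mulr_sumr -big_split.
Qed.

(* The competitor vanishes above level N and is the affine function below: its
   antisymmetric energy is a geometric tail of ratio rho / r. *)
Lemma trace_antisym_le r : rho < r < 1 ->
  exists2 t, 1 <= t & trace R 1 r t <= t * trace R (-1) r t.
Proof.
move=> /andP[hr r1]; have rh0 := rho_gt0 R; have r0 : 0 < r by apply: lt_trans hr.
have q : 0 <= rho / r < 1 by rewrite divr_ge0 ?(ltW rh0) ?(ltW r0) //= ltr_pdivrMr // mul1r.
have s0 : 0 < 1 - rho / r by case/andP: q; lra.
have A0 : 0 < trace R (-1) r 1 by apply: trace_gt0 => //; apply/andP.
set A := trace R (-1) r 1 in A0.
pose psi := extend R 1 (seed R (-1) 1).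
have Dpsi n : (1 <= n)%N -> dirichlet R (pattern n) (psi n) = 4 * rho ^+ n.-1.
  move=> h; rewrite /psi dirichlet_extend // subn1 mulrC; congr (_ * _).
  by rewrite /dirichlet /= big_ord_recl big_ord0 /= opprK divr1; ring.
pose C := 2 + 2 * rho / (1 - rho / r).
have C0 : 0 < C.
  have : 0 < rho / (1 - rho / r) by rewrite divr_gt0.
  by rewrite /C -mulrA; lra.
have [N0 hN0] := expr_small R (rho / r) (A / C * r) q (mulr_gt0 (divr_gt0 A0 C0) r0).
pose N := N0.+2.
pose chi n i := if (n < N)%N then 0 else psi n i.
pose phi := extend R N chi.
have chiN : chi N = psi N by rewrite /chi ltnn.
have fb : boundary R phi (-1) 1.
  split.
  - by rewrite /phi extend_low.
  - have := corner_extend_first R N chi.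
    by rewrite -/phi chiN /psi (extend_first R 1 (seed R (-1) 1) N) //.
  - have := corner_extend_last R N chi.
    by rewrite -/phi chiN /psi (extend_last R 1 (seed R (-1) 1) N).
have anti_ge0 x y z : 0 <= form_anti x y z by rewrite /form_anti; have := sqr_ge0 (y - z); lra.
have sym_ge0 x y z : 0 <= form_sym x y z by rewrite /form_sym; have := sqr_ge0 (2 * x - y - z); lra.
have half0 : 0 <= 2^-1 :> R by rewrite invr_ge0.
have anti_deg x z : form_anti x x z <= 2^-1 * (z - x) ^+ 2 by rewrite /form_anti; lra.
have sym_deg x z : form_sym x x z <= 2^-1 * (z - x) ^+ 2 by rewrite /form_sym; lra.
pose MS := energy R form_sym r chi N
  + 2^-1 * (rho * dirichlet R (pattern N) (chi N)) * r ^- N / (1 - rho / r).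
have ES n : energy R form_sym r phi n <= MS by exact: energy_extend.
have EA n : energy R form_anti r phi n <= A.
  apply: le_trans (energy_extend R form_anti r N chi n 2^-1 hr half0 anti_ge0 anti_deg) _.
  (* Above the cut only level N - 1 counts, and there tau sees the values of [psi] on the children,
     not the jump from 0 at their parent. *)
  have H : energy R form_anti r chi N <= 2 * rho ^+ N.-1 / r ^+ N.-1.
    rewrite /energy /N big_ord_recr /= big1 ?add0r => [|m _]; last first.
      rewrite /level /cellsum big1 ?mulr0 // => i _.
      by rewrite /form_anti /chi /N ltnS ltn_ord subrr; lra.
    rewrite mulrC ler_wpM2r ?invr_ge0 ?exprn_ge0 ?(ltW r0) //.
    apply: le_trans (_ : level R form_anti psi N0.+1 <= _).
      rewrite /level /cellsum; apply: ler_sum => i _.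
      by rewrite /form_anti /chi ltnn.
    apply: le_trans (level_extend R form_anti 1 (seed R (-1) 1) N0.+1 2^-1 half0 anti_deg isT) _.
    rewrite subn1 /= {1}/dirichlet /= big_ord_recl big_ord0 /= opprK divr1 addr0; lra.
  rewrite chiN Dpsi //.
  apply: le_trans (_ : C * (rho / r) ^+ N.-1 / r <= _).
    have -> : 2^-1 * (rho * (4 * rho ^+ N.-1)) * r ^- N / (1 - rho / r)
              = 2 * rho / (1 - rho / r) * (rho / r) ^+ N.-1 / r.
      rewrite (expr_div_n rho r) /N /= [r ^+ N0.+2]exprS; field.
      by rewrite expf_neq0 ?gt_eqF // subr_gt0.
    set y := (rho / r) ^+ N.-1; set w := 2 * rho / (1 - rho / r).
    have -> : C * y / r = 2 * y / r + w * y / r by rewrite /C -/w; ring.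
    rewrite lerD2r; apply: le_trans H _; rewrite -mulrA -(expr_div_n rho r) -/y.
    rewrite ler_peMr ?invf_ge1 ?(ltW r1) //.
    by rewrite mulr_ge0 // exprn_ge0 //; case/andP: q.
  rewrite ler_pdivrMr // mulrC -ler_pdivlMr // (mulrAC A); apply: ltW.
  by apply: hN0; rewrite /= leqnSn.
have MS0 : 0 <= MS by apply: le_trans (ES 0%N); rewrite /energy big_ord0.
(* This t makes t A = A + MS, so s costs at most MS <= t A, and t tau at most t A. *)
exists (1 + MS / A); first by rewrite lerDl divr_ge0 // ltW.
set t := 1 + MS / A; have t1 : 1 <= t by rewrite lerDl divr_ge0 // ltW.
have tA : t * A = A + MS by rewrite /t mulrDl mul1r divfK // gt_eqF.
apply: (trace_le R _ _ _ phi) => //; first by lra.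
move=> n; rewrite energy_split.
have := EA n; have := ES n => h1 h2.
have : t * energy R form_anti r phi n <= t * A by rewrite ler_wpM2l //; lra.
have : t * A <= t * trace R (-1) r t by rewrite ler_wpM2l ?trace_mono_t //; lra.
by lra.
Qed.

End Bounds.

(** * The eigenvalue problem *)

Section Eigenform.
Variable R : realType.
Local Notation rho := (rho R).
Implicit Types (phi psi : nat -> nat -> R) (k r t M : R).

(** * Continuity of the traces in r *)

Lemma exprD1_le n (y : R) : 0 <= y <= 1 -> (1 + y) ^+ n <= 1 + 3 ^+ n * y.
Proof.
move=> /andP[y0 y1]; elim: n => [|n IH]; first by rewrite !expr0 mul1r lerDl.
rewrite !exprS; have p1 : 1 <= 3 ^+ n :> R by apply: exprn_ege1; lra.
set a := (1 + y) ^+ n in IH *; set b := 3 ^+ n in IH p1 *.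
apply: le_trans (_ : (1 + y) * (1 + b * y) <= _); first by rewrite ler_wpM2l // addr_ge0.
have : 0 <= (b - 1) * y by rewrite mulr_ge0 // subr_ge0.
have : 0 <= b * y * (1 - y) by rewrite !mulr_ge0 ?subr_ge0 //; lra.
nra.
Qed.

Lemma expr_near1 n (x : R) : 0 < x -> exists2 del : R, 0 < del & (1 + del) ^+ n <= 1 + x.
Proof.
move=> x0; have p0 : 0 < 3 ^+ n :> R by rewrite exprn_gt0.
have d0 : 0 < Num.min 1 (x / 3 ^+ n) by rewrite lt_min ltr01 divr_gt0.
exists (Num.min 1 (x / 3 ^+ n)) => //.
apply: le_trans (exprD1_le n _ _) _; first by rewrite (ltW d0) ge_min lexx.
by rewrite lerD2l mulrC -ler_pdivlMr // ge_min lexx orbT.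
Qed.

Lemma sum_pairs (e : nat -> R) m :
  \sum_(j < m) (e (2 * j)%N + e (2 * j).+1) = \sum_(i < 2 * m) e i.
Proof.
elim: m => [|m IH]; first by rewrite muln0 !big_ord0.
by rewrite big_ord_recr IH mulnS !big_ord_recr /= addrA.
Qed.

(** Pigeonhole over disjoint pairs of consecutive levels: a cut needs little energy both above and
    below its row of nodes. *)
Lemma small_pair (e : nat -> R) m M : (0 < m)%N -> 0 < M -> \sum_(i < 2 * m) e i <= M ->
  exists2 j, (j < m)%N & e (2 * j)%N + e (2 * j).+1 <= 2 * M / m%:R.
Proof.
move=> m0 M0; rewrite -sum_pairs => H; have mR : 0 < m%:R :> R by rewrite ltr0n.
have [/existsP[j hj]|/existsPn h] :=
  boolP [exists j : 'I_m, e (2 * j)%N + e (2 * j).+1 <= 2 * M / m%:R].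
  by exists j.
have : \sum_(j < m) 2 * M / m%:R <= \sum_(j < m) (e (2 * j)%N + e (2 * j).+1).
  by apply: ler_sum => j _; have := h j; rewrite -ltNge => /ltW.
rewrite sumr_const card_ord -[X in X <= _]mulr_natr divfK ?gt_eqF //; lra.
Qed.

(* Cut a near-minimizer at a level [n.+1] around which it has little energy and extend it
   linearly below: for r > rho the extension costs no more than the levels next to the cut. *)
Lemma extend_energy_le t r r' ra phi n Q (E : R) : rho < ra -> ra <= r -> r <= r' -> r' <= 1 ->
  1 <= t -> (forall m, (m <= n)%N -> (r' / r) ^+ m <= Q) ->
  r' ^- n * level R (cell_form R t) phi n + r' ^- n.+1 * level R (cell_form R t) phi n.+1 <= E ->
  forall m, energy R (cell_form R t) r (extend R n.+1 phi) m <=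
    Q * (energy R (cell_form R t) r' phi n.+1 + 2 * (1 + t) / (1 - rho / ra) * E).
Proof.
move=> ha har rr r1 t1 hQ hE m; have rh0 := rho_gt0 R.
have ra0 : 0 < ra by apply: lt_trans ha.
have r0 : 0 < r by apply: lt_le_trans har.
have r'0 : 0 < r' by apply: lt_le_trans rr.
have t0 : 0 <= t by lra.
have cf0 x y z : 0 <= cell_form R t x y z by apply: cell_form_ge0.
have C0 : 0 <= (1 + t) / 2 by lra.
have lev0 j : 0 <= level R (cell_form R t) phi j by apply: cellsum_ge0.
have Q0 : 1 <= Q by have := hQ 0%N isT; rewrite expr0.
have rho_r : rho < r by apply: lt_le_trans har.
apply: le_trans (energy_extend R (cell_form R t) r n.+1 phi m _ rho_r C0 cf0 (cell_form_degenerate R t)) _.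
have wt j : (j <= n)%N -> r ^- j <= Q * r' ^- j.
  move=> hj; have := hQ j hj; rewrite (expr_div_n r' r) ler_pdivrMr ?exprn_gt0 // => h.
  by rewrite -[leLHS]mul1r ler_pdivrMr ?exprn_gt0 // mulrAC ler_pdivlMr ?exprn_gt0 // mul1r.
rewrite mulrDr; apply: lerD.
  rewrite /energy mulr_sumr; apply: ler_sum => j _; rewrite mulrA ler_wpM2r ?wt //.
  by rewrite -ltnS ltn_ord.
have hD := dirichlet_le_cellsum R t (pattern n) (phi n) (phi n.+1) (phi n.+2) t1.
rewrite -/(pattern n.+1) -/(level R (cell_form R t) phi n) -/(level R (cell_form R t) phi n.+1) in hD.
set L1 := level R _ phi n in hE hD *; set L2 := level R _ phi n.+1 in hE hD *.
set D := dirichlet _ _ _ in hD *.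
have D0 : 0 <= D by apply: dirichlet_ge0.
have L10 : 0 <= L1 by apply: lev0. have L20 : 0 <= L2 by apply: lev0.
have p0 : 0 < r' ^+ n by rewrite exprn_gt0.
have hL : L1 + L2 <= r' ^+ n * E.
  rewrite mulrC -ler_pdivrMr // mulrDl; apply: le_trans hE.
  rewrite mulrC lerD2l mulrC ler_wpM2r // exprS invfM ler_peMl ?invr_ge0 ?(ltW p0) //.
  by rewrite invf_ge1.
have E0 : 0 <= E.
  by apply: le_trans hE; rewrite addr_ge0 // mulr_ge0 // invr_ge0 exprn_ge0 // ltW.
have sa : 0 < 1 - rho / ra by rewrite subr_gt0 ltr_pdivrMr // mul1r.
have sar : 1 - rho / ra <= 1 - rho / r.
  by rewrite lerD2l lerN2 ler_wpM2l ?(ltW rh0) // lef_pV2 ?posrE.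
have s0 : 0 < 1 - rho / r by apply: lt_le_trans sar.
apply: le_trans (_ : (1 + t) / 2 * (rho * (4 * (r' ^+ n * E))) * r ^- n.+1 / (1 - rho / r) <= _).
  have h : (1 + t) / 2 * (rho * D) <= (1 + t) / 2 * (rho * (4 * (r' ^+ n * E))).
    by do 2 apply: ler_wpM2l => //; [exact: ltW|lra].
  by apply: ler_wpM2r; [rewrite invr_ge0 ltW|apply: ler_wpM2r => //; rewrite invr_ge0 exprn_ge0 // ltW].
have -> : (1 + t) / 2 * (rho * (4 * (r' ^+ n * E))) * r ^- n.+1 / (1 - rho / r)
  = (rho / r) * (r' / r) ^+ n * (2 * (1 + t) / (1 - rho / r) * E).
  by rewrite (expr_div_n r' r) exprS; field; rewrite expf_neq0 ?gt_eqF //= subr_gt0.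
have X0 : 0 <= 2 * (1 + t) / (1 - rho / r) * E.
  by apply: mulr_ge0 => //; apply: divr_ge0; [lra|exact: ltW].
apply: le_trans (_ : Q * (2 * (1 + t) / (1 - rho / r) * E) <= _).
  apply: ler_wpM2r => //; apply: le_trans (hQ n (leqnn _)).
  by apply: ler_piMl; [rewrite exprn_ge0 // divr_ge0 // ltW|rewrite ler_pdivrMr // mul1r ltW].
apply: ler_wpM2l; first by lra.
apply: ler_wpM2r => //; apply: ler_wpM2l; first by lra.
by rewrite lef_pV2 ?posrE.
Qed.

(** Cutting changes the values at both corners; by symmetry they are off by the same factor, which
    one rescaling corrects. *)
Lemma boundary_extend_sym k phi N : k * k = 1 -> phi 0%N 0%N = 0 -> phi N 0%N != 0 ->
  (forall n i, (i <= size (pattern n))%N -> reflect R phi n i = - k * phi n i) ->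
  boundary R (fun n i => - (phi N 0%N)^-1 * extend R N phi n i) (-1) k.
Proof.
move=> kk h0 w0 hs.
have hl : phi N (size (pattern N)) = - k * phi N 0%N by rewrite -hs // /reflect subn0.
have hb : boundary R (extend R N phi) (phi N 0%N) (- k * phi N 0%N).
  split; first by rewrite extend_low.
    exact: corner_extend_first.
  by rewrite -hl; exact: corner_extend_last.
have := boundary_scale R _ _ _ (- (phi N 0%N)^-1) hb.
have -> : - (phi N 0%N)^-1 * phi N 0%N = -1 by rewrite mulNr mulVf.
by have -> : - (phi N 0%N)^-1 * (- k * phi N 0%N) = k by field.
Qed.

(** Bookkeeping for the three losses of a cut: [Q] from the change of weights, [c] from the
    extension, and [w], close to -1, from the corner values. *)
Lemma cut_error (eta c Q w : R) : 0 < eta <= 1 -> 0 <= c -> c <= eta / 8 -> 0 <= Q ->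
  Q <= 1 + eta / 8 -> (w + 1) ^+ 2 <= (eta / 16) ^+ 2 ->
  w != 0 /\ Q * (1 + c) <= (1 + eta) * w ^+ 2.
Proof.
move=> /andP[e0 e1] c0 c1 Q0 Q1 hw.
have [w1 w2] : - (eta / 16) <= w + 1 /\ w + 1 <= eta / 16.
  have : `|w + 1| <= eta / 16.
    by rewrite -(@ler_pXn2r _ 2) ?nnegrE ?normr_ge0 ?real_normK ?num_real //; lra.
  by rewrite ler_norml => /andP[].
split; first by apply/eqP; lra.
have b1 : Q * (1 + c) <= (1 + eta / 8) * (1 + eta / 8) by apply: ler_pM => //; lra.
have b2 : (1 - eta / 16) ^+ 2 <= w ^+ 2 by nra.
have b3 : (1 + eta / 8) * (1 + eta / 8) <= (1 + eta) * (1 - eta / 16) ^+ 2.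
  have : 0 <= eta * (1 - eta) by nra.
  have : 0 <= eta * eta * eta by rewrite !mulr_ge0 // ltW.
  nra.
by apply: le_trans b1 _; apply: le_trans b3 _; rewrite ler_wpM2l //; lra.
Qed.

(** A near-minimizer for the larger ratio r' is cut between the levels K and 3 K, extended linearly
    and rescaled; the result competes for r. Together with [trace_mono_r] this is continuity,
    uniform on [ra, rb]. *)
Lemma trace_continuous k ra rb t eta : k * k = 1 -> rho < ra -> rb < 1 -> 1 <= t ->
  0 < eta <= 1 -> exists2 del : R, 0 < del & forall r r', ra <= r -> r <= r' -> r' <= rb ->
  r' <= r * (1 + del) -> trace R k r t <= (1 + eta) * trace R k r' t.
Proof.
move=> kk ha hb t1 e01; have /andP[e0 e1] := e01; have t0 : 0 <= t by lra.
have ra0 : 0 < ra by apply: lt_trans ha; exact: rho_gt0.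
have [M0 M00 hM0] : exists2 M0, 0 < M0 & trace R k ra t < M0.
  by exists (trace R k ra t + 1); have := trace_ge0 R k ra t ha t0; lra.
pose C := 2 * (1 + t) / (1 - rho / ra).
have C0 : 0 < C.
  by rewrite /C divr_gt0 //; [lra|rewrite subr_gt0 ltr_pdivrMr // mul1r].
have sb : 0 < 1 - rb by lra.
have [rb0|rb0] := lerP rb 0.
  by exists 1; [exact: ltr01|move=> r r' h1 h2 h3 h4; exfalso; lra].
have s20 : 0 < (eta / 16) ^+ 2 * (1 - rb) / (2 * M0).
  by rewrite divr_gt0 ?mulr_gt0 // exprn_gt0 //; lra.
(* K is large enough for the corner values at the cut to be nearly right and for the energy found by
   pigeonhole to be small. *)
have [K [K0 a2 CK]] : exists K : nat, [/\ (0 < K)%N,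
    rb ^+ K < (eta / 16) ^+ 2 * (1 - rb) / (2 * M0) & C * 4 / K%:R <= eta / 8].
  have [K1 hK1] := expr_small R rb _ (introT andP (conj (ltW rb0) hb)) s20.
  have := @archi_boundP R (32 * C / eta); set K2 := Num.bound _ => hK2.
  exists (K1 + K2).+1; split => //.
    by apply: hK1; apply: leq_trans (leqnSn _); apply: leq_addr.
  have : K2%:R <= (K1 + K2).+1%:R :> R.
    by rewrite ler_nat; apply: leq_trans (leqnSn _); apply: leq_addl.
  have : 32 * C / eta < K2%:R by apply: hK2; apply: ltW; apply: divr_gt0 => //; lra.
  rewrite ltr_pdivrMr // ler_pdivrMr ?ltr0n // => h1 h2; nra.
have KR : 0 < K%:R :> R by rewrite ltr0n.
rewrite ltr_pdivlMr ?mulr_gt0 // in a2.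
(* Chosen after K, so that all weights up to level 3 K change by at most the factor 1 + eta / 8. *)
have [del d0 hdel] := expr_near1 (3 * K) (eta / 8) (divr_gt0 e0 (ltr0Sn _ 7)).
exists del => // r r' h1 h2 h3 h4.
have r0 : 0 < r by lra. have r'0 : 0 < r' by lra. have r'1 : r' < 1 by lra.
have hr : rho < r by lra. have hr' : rho < r' by lra.
have T0 : trace R k r' t < M0 by apply: le_lt_trans hM0; apply: trace_mono_r => //; lra.
(* Near-minimizers are available for M above the infimum; M then tends to it. *)
suff H M : trace R k r' t < M -> M <= M0 -> trace R k r t <= (1 + eta) * M.
  move: (trace R k r t) (trace R k r' t) T0 H => T T' T0 H; clear - e0 T0 H.
  rewrite leNgt; apply/negP => h; pose M := Num.min M0 ((T' + T / (1 + eta)) / 2).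
  have q : T' < T / (1 + eta) by rewrite ltr_pdivlMr; [rewrite mulrC|lra].
  have m1 : M <= M0 by rewrite ge_min lexx.
  have m2 : M <= (T' + T / (1 + eta)) / 2 by rewrite ge_min lexx orbT.
  have m3 : T' < M by rewrite lt_min; apply/andP; split; lra.
  have := H M m3 m1; rewrite mulrC -ler_pdivrMr; lra.
move=> hM MM0; have [phi [[p0 p1 p2] he hs]] := trace_approx_sym R k r' t M kk hr' t0 hM.
have Mp : 0 < M by apply: le_lt_trans hM; apply: trace_ge0.
pose e m := r' ^- (K + m) * level R (cell_form R t) phi (K + m).
(* The 2 K levels from level K on form K pairs, of total energy at most 2 M. *)
have [|||j jK hj] := small_pair e K (2 * M) => //; first by rewrite mulr_gt0.
  apply: le_trans (he (K + 2 * K)%N); rewrite /energy [leRHS]big_split_ord lerDr.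
  by apply: (energy_form_ge0 R t r' phi K).
have [n nE [nK Kn]] : exists2 n, n = (K + 2 * j)%N & (n <= 3 * K)%N /\ (K <= n.+1)%N.
  by exists (K + 2 * j)%N => //; clear - jK; split; lia.
have hE : r' ^- n * level R (cell_form R t) phi n + r' ^- n.+1 * level R (cell_form R t) phi n.+1
    <= 4 * M / K%:R.
  apply: le_trans (_ : 2 * (2 * M) / K%:R <= _); first by move: hj; rewrite /e addnS -nE.
  by rewrite mulrA -natrM.
pose N := n.+1; pose Q := (1 + del) ^+ (3 * K).
have hQ m : (m <= n)%N -> (r' / r) ^+ m <= Q.
  move=> mn; apply: le_trans (_ : (1 + del) ^+ m <= _).
    rewrite lerXn2r ?nnegrE ?divr_ge0 ?(ltW r0) ?(ltW r'0) //.
      by rewrite addr_ge0 // ltW.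
    by rewrite ler_pdivrMr // mulrC.
  by apply: ler_weXn2l; [rewrite lerDl ltW|apply: leq_trans mn _; exact: nK].
have Q0 : 0 <= Q by rewrite /Q exprn_ge0 // addr_ge0 // ltW.
have hG m : energy R (cell_form R t) r (extend R N phi) m <= Q * (2 * M * (1 + C * 4 / K%:R)).
  apply: le_trans (extend_energy_le t r r' ra phi n Q _ ha h1 h2 (ltW r'1) t1 hQ hE m) _.
  apply: ler_wpM2l => //; rewrite -/C.
  have -> : 2 * M * (1 + C * 4 / K%:R) = 2 * M + C * (4 * M / K%:R) * 2 by ring.
  apply: lerD; first exact: he.
  rewrite ler_peMr ?ler1n // mulr_ge0 ?(ltW C0) // divr_ge0 ?ler0n // mulr_ge0 //; exact: ltW.
set w := phi N 0%N.
have hw : (w + 1) ^+ 2 <= (eta / 16) ^+ 2.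
  have r01 : 0 < r' < 1 by rewrite r'0.
  have := corner_energy_bound R t r' phi (-1) N _ t1 r01 p1 he; rewrite opprK -/w => h.
  apply: le_trans h _.
  have a1 : r' ^+ N <= rb ^+ K.
    apply: le_trans (_ : rb ^+ N <= _); first by rewrite lerXn2r ?nnegrE // ltW.
    by apply: ler_wiXn2l; [exact: ltW|exact: ltW|exact: Kn].
  have a3 : r' ^+ N * (2 * M) <= rb ^+ K * (2 * M0).
    by apply: ler_pM => //; rewrite ?exprn_ge0 ?mulr_ge0 // ?(ltW r'0) ?(ltW Mp) // ler_pM2l.
  have q : 0 < 1 - r' by rewrite subr_gt0.
  rewrite mulrAC ler_pdivrMr //; apply: le_trans a3 _; apply: le_trans (ltW a2) _.
  by apply: ler_wpM2l; rewrite ?sqr_ge0 // lerD2l lerN2.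
have CK0 : 0 <= C * 4 / K%:R by rewrite divr_ge0 ?ler0n // mulr_ge0 // ltW.
have [wn0 b4] := cut_error eta _ Q w e01 CK0 CK Q0 hdel hw.
have bd := boundary_extend_sym k phi N kk p0 wn0 hs.
apply: le_trans (trace_le R k r t _ (Q * (M * (1 + C * 4 / K%:R)) / w ^+ 2) hr t0 bd _) _.
  move=> m; rewrite energy_scale sqrrN exprVn -/w mulrC.
  apply: le_trans (_ : Q * (2 * M * (1 + C * 4 / K%:R)) / w ^+ 2 <= _).
    by rewrite ler_wpM2r ?hG // invr_ge0 sqr_ge0.
  by rewrite le_eqVlt; apply/orP; left; apply/eqP; ring.
have wp : 0 < w ^+ 2 by rewrite exprn_even_gt0.
rewrite ler_pdivrMr //.
have -> : Q * (M * (1 + C * 4 / K%:R)) = M * (Q * (1 + C * 4 / K%:R)) by ring.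
have -> : (1 + eta) * M * w ^+ 2 = M * ((1 + eta) * w ^+ 2) by ring.
by rewrite ler_wpM2l // ltW.
Qed.

(** Monotonicity takes the place of continuity: at the supremum s of the t with t A t <= G t, the
    monotonicity of A t / t and of G excludes both strict inequalities. *)
Lemma fixed_ratio (A G : R -> R) (T : R) : 1 <= T -> 0 < A 1 ->
  (forall t t', 1 <= t -> t <= t' -> A t <= A t') ->
  (forall t t', 1 <= t -> t <= t' -> t * A t' <= t' * A t) ->
  (forall t t', 1 <= t -> t <= t' -> G t <= G t') ->
  A 1 <= G 1 -> G T <= T * A T -> exists2 t, 1 <= t & G t = t * A t.
Proof.
move=> T1 A0 mA rA mG h1 hT.
pose S := [set t : R | (1 <= t <= T) && (t * A t <= G t)].
have S1 : S 1 by rewrite /S /= lexx T1 mul1r.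
have hS : has_sup S by split; [exists 1|exists T => t /andP[/andP[]]].
set s := sup S; have s1 : 1 <= s by apply: ub_le_sup => //; case: hS.
have sT : s <= T by apply: ge_sup; [case: hS|move=> t /andP[/andP[]]].
have As : 0 < A s by apply: lt_le_trans A0 (mA _ _ (lexx _) s1).
have sA : 0 < s * A s by rewrite mulr_gt0 //; lra.
have le1 : s * A s <= G s.
  rewrite leNgt; apply/negP => h; pose c := G s / (s * A s).
  have c1 : c < 1 by rewrite ltr_pdivrMr // mul1r.
  have Gs : G s = c * (s * A s) by rewrite /c divfK // gt_eqF.
  (* Every t of the set satisfies t^2 <= c s^2, and sqrt c <= (1 + c) / 2 < 1 keeps it below s by a
     fixed factor. *)
  have : s <= s * (1 + c) / 2.
    apply: ge_sup; first by case: hS.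
    move=> t /andP[/andP[t1 tT] ht]; have ts : t <= s.
      by apply: ub_le_sup; [case: hS|rewrite /S /= t1 tT].
    have g1 := mG _ _ t1 ts; have g2 := rA _ _ t1 ts; rewrite Gs in g1.
    have g3 : t * t <= c * (s * s).
      rewrite -(ler_pM2r As); nra.
    have g4 : t * t <= (s * (1 + c) / 2) * (s * (1 + c) / 2).
      apply: le_trans g3 _; have := sqr_ge0 (s * (1 - c)); nra.
    rewrite leNgt; apply/negP => g5; have : 0 <= s * (1 + c) / 2; last by nra.
    have G0 : 0 <= G s by apply: le_trans (mG _ _ (lexx _) s1); lra.
    have c0 : 0 <= c by rewrite divr_ge0 // ltW.
    nra.
  nra.
have le2 : G s <= s * A s.
  rewrite leNgt; apply/negP => h.
  have sT' : s < T by rewrite lt_neqAle sT andbT; apply/eqP => e; move: h; rewrite e; lra.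
  pose q := G s / (s * A s); have q1 : 1 < q by rewrite ltr_pdivlMr // mul1r.
  have Gs : G s = q * (s * A s) by rewrite /q divfK // gt_eqF.
  (* The harmonic mean of 1 and q, a rational substitute for the square root: 1 < y and y^2 <= q. *)
  pose y := 2 * q / (q + 1).
  have yq : y * (q + 1) = 2 * q by rewrite /y divfK // gt_eqF //; lra.
  have y1 : 1 < y by nra.
  have y2 : y * y <= q.
    have qq : 0 < (q + 1) * (q + 1) by nra.
    rewrite -(ler_pM2r qq); have := sqr_ge0 (q - 1).
    have -> : y * y * ((q + 1) * (q + 1)) = (y * (q + 1)) * (y * (q + 1)) by ring.
    by rewrite yq; nra.
  pose t := Num.min T (s * y).
  have st : s < t by rewrite lt_min sT'; nra.
  have t1 : 1 <= t by lra.
  have ty : t <= s * y by rewrite ge_min lexx orbT.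
  have : t <= s; last by lra.
  apply: ub_le_sup; first by case: hS.
  rewrite /S /= t1 ge_min lexx /=.
  apply: le_trans (mG _ _ s1 (ltW st)); rewrite Gs.
  have := rA _ _ s1 (ltW st) => g.
  have s0 : 0 < s by lra.
  rewrite -(ler_pM2l s0); apply: le_trans (_ : t * (t * A s) <= _); first by nra.
  apply: le_trans (_ : (s * y) * ((s * y) * A s) <= _).
    by apply: ler_pM => //; [lra|nra|nra].
  have : 0 <= s * s * A s by rewrite !mulr_ge0 // ltW.
  nra.
by exists s => //; apply/eqP; rewrite eq_le le1 le2.
Qed.

(** * Solutions for fixed r and their comparison *)

Lemma eigenform_at r : rho < r < 1 ->
  exists2 t, 1 <= t & trace R 1 r t = t * trace R (-1) r t.
Proof.
move=> hr; have /andP[h0 _] := hr; have [T T1 hT] := trace_antisym_le R r hr.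
apply: (fixed_ratio _ _ T) => //.
- exact: trace_gt0.
- by move=> t t' t1 tt; apply: trace_mono_t => //; lra.
- by move=> t t' t1 tt; apply: trace_ratio_t => //; lra.
- by move=> t t' t1 tt; apply: trace_mono_t => //; lra.
- exact: trace_sym_le_antisym.
Qed.

(** Comparison of a subsolution, with [a], and a supersolution, with [b]: for t' <= t by
    monotonicity of A, otherwise by that of G / t. *)
Lemma eigenvalue_compare r t t' (a b : R) : rho < r < 1 -> 1 <= t -> 1 <= t' ->
  trace R (-1) r t <= a -> trace R 1 r t <= t * a ->
  b <= trace R (-1) r t' -> t' * b <= trace R 1 r t' -> b <= a.
Proof.
move=> /andP[hr r1] t1 t'1 ha hat hb hbt; have [tt|/ltW tt] := lerP t' t.
  by apply: le_trans hb _; apply: le_trans ha; apply: trace_mono_t => //; lra.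
have t0 : 0 < t by lra.
have := trace_ratio_t R 1 r t t' hr t0 tt => h.
have t'0 : 0 < t' by lra.
rewrite -(ler_pM2l t0) -(ler_pM2l t'0); nra.
Qed.

(** By monotonicity in r, the solution at the larger ratio is a supersolution at the smaller one. *)
Lemma eigenform_unique r r' t t' : rho < r < 1 -> rho < r' < 1 -> 1 <= t -> 1 <= t' ->
  trace R (-1) r t = r ^+ 2 -> trace R 1 r t = t * r ^+ 2 ->
  trace R (-1) r' t' = r' ^+ 2 -> trace R 1 r' t' = t' * r' ^+ 2 -> r = r'.
Proof.
wlog rr : r r' t t' / r <= r'.
  move=> W h h' t1 t'1 e1 e2 e3 e4; have [rr|/ltW rr] := lerP r r'; first exact: (W r r' t t').
  by apply/esym; apply: (W r' r t' t).
move=> h h' t1 t'1 e1 e2 e3 e4; have /andP[r0 r1] := h.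
apply/eqP; rewrite eq_le rr /=.
have rp : 0 < r by have := rho_gt0 R; lra.
suff : r' ^+ 2 <= r ^+ 2 by rewrite ler_pXn2r // nnegrE; lra.
apply: (eigenvalue_compare r t t') => //; rewrite ?e1 ?e2 //.
  by rewrite -e3; apply: trace_mono_r => //; lra.
by rewrite -e4; apply: trace_mono_r => //; lra.
Qed.

Lemma traces_continuous t eta : 1 <= t -> 0 < eta <= 1 ->
  exists2 del : R, 0 < del & forall r r', 31 / 50 <= r -> r <= r' -> r' <= 19 / 20 ->
  r' <= r * (1 + del) ->
  trace R (-1) r t <= (1 + eta) * trace R (-1) r' t /\
  trace R 1 r t <= (1 + eta) * trace R 1 r' t.
Proof.
move=> t1 he; have /andP[_ ha] := rho_bounds R.
have hb : 19 / 20 < 1 :> R by lra.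
have [d1 d10 H1] := trace_continuous (-1) _ _ t eta (etrans (mulrNN 1 1) (mulr1 1)) ha hb t1 he.
have [d2 d20 H2] := trace_continuous 1 _ _ t eta (mulr1 1) ha hb t1 he.
exists (Num.min d1 d2); first by rewrite lt_min d10.
move=> r r' h1 h2 h3 h4; have r0 : 0 <= r by apply: le_trans h1; lra.
by split; [apply: H1|apply: H2] => //; apply: le_trans h4 _;
  rewrite ler_wpM2l // lerD2l ge_min lexx ?orbT.
Qed.

(** One factor 1 + eta absorbs the change of the trace, the squared one the change of r^2. The 8 in
    [eta] suffices since (1 + eta)^3 <= 1 + 7 eta for eta <= 1. *)
Lemma small_gap (x y : R) : 0 < x -> x < y ->
  exists2 eta : R, 0 < eta <= 1 & (1 + eta) * (1 + eta) ^+ 2 * x < y.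
Proof.
move=> x0 xy; pose eta := Num.min 1 ((y / x - 1) / 8).
have L1 : 0 < y / x - 1 by rewrite subr_gt0 ltr_pdivlMr // mul1r.
have e0 : 0 < eta by rewrite lt_min ltr01 divr_gt0.
have e1 : eta <= 1 by rewrite ge_min lexx.
have e2 : eta <= (y / x - 1) / 8 by rewrite ge_min lexx orbT.
exists eta; first by rewrite e0.
clearbody eta; have h : (1 + 8 * eta) * x <= y by rewrite -ler_pdivlMr //; lra.
have : 0 < eta * x by rewrite mulr_gt0.
have : 0 <= eta * (1 - eta) * x by rewrite !mulr_ge0 // ?subr_ge0 // ltW.
have : 0 <= eta * eta * (1 - eta) * x by rewrite !mulr_ge0 ?subr_ge0 // ltW.
nra.
Qed.

(** If the eigenvalue at s exceeds s^2, the same t is still a supersolution slightly to the right,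
    so s is not the supremum. *)
Lemma supersolution_right s t : 5 / 8 <= s <= 9 / 10 -> 1 <= t ->
  trace R 1 s t = t * trace R (-1) s t -> s ^+ 2 < trace R (-1) s t ->
  exists r, [/\ s < r, r <= 19 / 20, r ^+ 2 <= trace R (-1) r t & t * r ^+ 2 <= trace R 1 r t].
Proof.
move=> /andP[s0 s9] t1 et hlt; have sp : 0 < s by lra.
have [eta he e3] := small_gap _ _ (exprn_gt0 2 sp) hlt; have /andP[e0 _] := he.
have [d1 d10 H] := traces_continuous t eta t1 he.
have [d d0 [dd1 dd2 dd3]] : exists2 d, 0 < d & [/\ d <= d1, d <= eta & d <= 1 / 20].
  exists (Num.min d1 (Num.min eta (1 / 20))); last by split; rewrite !ge_min lexx ?orbT.
  by rewrite !lt_min d10 e0 divr_gt0.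
have rs : s < s * (1 + d) by rewrite ltr_pMr // ltrDl.
have r20 : s * (1 + d) <= 19 / 20 by clear - s9 d0 dd3 sp; nra.
have s31 : 31 / 50 <= s by lra.
have rd : s * (1 + d) <= s * (1 + d1) by rewrite ler_pM2l // lerD2l.
have [f1 f2] := H s _ s31 (ltW rs) r20 rd; rewrite et in f2; exists (s * (1 + d)); split => //.
all: set r := s * (1 + d) in f1 f2 *.
all: have r2 : r ^+ 2 <= (1 + eta) ^+ 2 * s ^+ 2 by
  rewrite /r exprMn mulrC ler_wpM2r ?sqr_ge0 // lerXn2r ?nnegrE ?lerD2l // addr_ge0 // ltW.
all: have ee : 0 < 1 + eta by rewrite addr_gt0.
all: have g : (1 + eta) * r ^+ 2 <= trace R (-1) s t by
  apply: le_trans (ltW e3); rewrite -mulrA ler_wpM2l // ltW.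
  by rewrite -(ler_pM2l ee); apply: le_trans f1.
rewrite -(ler_pM2l ee) mulrCA; apply: le_trans f2; rewrite ler_wpM2l //.
by apply: le_trans t1.
Qed.

(** If the eigenvalue at s is below s^2, the same t is a strict subsolution slightly to the left,
    which excludes supersolutions there. *)
Lemma supersolution_left s t : 5 / 8 <= s <= 9 / 10 -> 1 <= t ->
  trace R 1 s t = t * trace R (-1) s t -> trace R (-1) s t < s ^+ 2 ->
  exists2 del : R, 0 < del & forall r, 31 / 50 <= r -> r <= s -> s <= r * (1 + del) ->
  exists b, [/\ b < r ^+ 2, trace R (-1) r t <= b & trace R 1 r t <= t * b].
Proof.
move=> /andP[s0 s9] t1 et hlt; have /andP[rh0 rh1] := rho_bounds R.
have lam0 : 0 < trace R (-1) s t by apply: trace_gt0 => //; lra.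
have [eta he e3] := small_gap _ _ lam0 hlt; have /andP[e0 _] := he.
have [d1 d10 H] := traces_continuous t eta t1 he.
exists (Num.min d1 eta); first by rewrite lt_min d10.
move=> r r31 rs rd; exists ((1 + eta) * trace R (-1) s t).
have r0 : 0 < r by lra.
have s20 : s <= 19 / 20 by lra.
have rd1 : s <= r * (1 + d1).
  by apply: le_trans rd _; rewrite ler_pM2l // lerD2l ge_min lexx.
have [f1 f2] := H r s r31 rs s20 rd1; split => //; last by rewrite mulrCA -et.
have ee : 0 < (1 + eta) ^+ 2 by rewrite exprn_gt0 // addr_gt0.
rewrite -(ltr_pM2r ee) mulrAC; apply: lt_le_trans e3 _; rewrite -exprMn.
have se : s <= r * (1 + eta).
  by apply: le_trans rd _; rewrite ler_pM2l // lerD2l ge_min lexx orbT.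
by rewrite lerXn2r ?nnegrE //; [lra|apply: le_trans se; lra].
Qed.

Lemma eigenform_exists : exists r t, [/\ rho < r < 1, 1 <= t,
  trace R (-1) r t = r ^+ 2 & trace R 1 r t = t * r ^+ 2].
Proof.
have /andP[_ rh] := rho_bounds R.
pose P := [set r : R | rho < r < 1 /\ exists t, [/\ 1 <= t, r ^+ 2 <= trace R (-1) r t &
  t * r ^+ 2 <= trace R 1 r t]].
have Pr0 : P (5 / 8).
  split; first by lra.
  exists 1; rewrite mul1r; split => //; apply: trace_start; ring.
have Pub r : P r -> r <= 9 / 10.
  move=> [/andP[r0 r1] [t [t1 h _]]]; rewrite leNgt; apply/negP => h9.
  by have := trace_symmetric_lt R r t; rewrite r1 (ltW h9) => /(_ isT t1); lra.
have hP : has_sup P by split; [exists (5 / 8)|exists (9 / 10)].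
have [s [s_ub s_gt s0 s9]] : exists s, [/\ forall r, P r -> r <= s,
    forall x, x < s -> exists2 r, P r & x < r, 5 / 8 <= s & s <= 9 / 10].
  exists (sup P); split; [|by move=> x; apply: sup_gt; case: hP| |].
  - by move=> r hr; apply: ub_le_sup => //; case: hP.
  - by apply: ub_le_sup => //; case: hP.
  - by apply: ge_sup => //; case: hP.
have sp : 0 < s by lra.
have hs : rho < s < 1 by lra.
have [t t1 et] := eigenform_at s hs.
have s089 : 5 / 8 <= s <= 9 / 10 by rewrite s0.
exists s, t; suff lams : trace R (-1) s t = s ^+ 2 by rewrite -lams; split.
apply/eqP; rewrite eq_le; apply/andP; split; rewrite leNgt; apply/negP => hlam.
  have [r [sr r20 h1 h2]] := supersolution_right s t s089 t1 et hlam.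
  have : r <= s; last by lra.
  by apply: s_ub; split; [lra|exists t].
have [d d0 H] := supersolution_left s t s089 t1 et hlam.
have [r Pr] : exists2 r, P r & Num.max (31 / 50) (s / (1 + d)) < r.
  apply: s_gt; rewrite gt_max; apply/andP; split; first by lra.
  by rewrite ltr_pdivrMr ?ltr_pMr ?ltrDl // addr_gt0.
rewrite gt_max => /andP[r31]; rewrite ltr_pdivrMr ?addr_gt0 // => rd.
have [b [br f1 f2]] := H r (ltW r31) (s_ub _ Pr) (ltW rd).
have [hr [t' [t'1 hA hG]]] := Pr.
by have := eigenvalue_compare r t t' _ _ hr t1 t'1 f1 f2 hA hG; rewrite leNgt br.
Qed.

End Eigenform.

(** * Transfer to the set W1 *)

Section Gasket.
Variable R : realType.
Local Notation rho := (rho R).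
Implicit Types (phi : nat -> nat -> R) (f : pt R -> R) (u : 'I_3 -> R).

Definition o0 : 'I_3 := inord 0.
Definition o1 : 'I_3 := inord 1.
Definition o2 : 'I_3 := inord 2.

Lemma ord3_cases (i : 'I_3) : [\/ i = o0, i = o1 | i = o2].
Proof.
case: i => -[|[|[|//]]] h; [apply: Or31|apply: Or32|apply: Or33];
  by apply: val_inj; rewrite /= inordK.
Qed.

Lemma sum_ord3 (G : 'I_3 -> R) : \sum_i G i = G o0 + G o1 + G o2.
Proof.
rewrite !big_ord_recl big_ord0 addr0 addrA; congr (G _ + G _ + G _);
  by apply: val_inj; rewrite /= ?inordK.
Qed.

Lemma Dform_cell (a : 'M[R]_3) u : in_MS a -> 0 < a o0 o1 ->
  Dform a u u = a o0 o1 * cell_form R (1 + 2 * a o1 o2 / a o0 o1) (u o0) (u o1) (u o2).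
Proof.
move=> [[sa [da _]] e] a0; rewrite /Dform !sum_ord3 !da.
rewrite (sa o1 o0) (sa o2 o0) (sa o2 o1) -[a o0 o2]e -/o0 -/o1 /cell_form.
by field; rewrite gt_eqF.
Qed.

Lemma q0E : q R o0 = (1 / 2, Num.sqrt 3 / 2). Proof. by rewrite /q /= inordK. Qed.
Lemma q1E : q R o1 = (0, 0). Proof. by rewrite /q /= inordK. Qed.
Lemma q2E : q R o2 = (1, 0). Proof. by rewrite /q /= inordK. Qed.

Lemma sqrt3_bounds : 1 < Num.sqrt (3 : R) < 2.
Proof.
have h : Num.sqrt (3 : R) ^+ 2 = 3 by rewrite sqr_sqrtr.
by have h0 := sqrtr_ge0 (3 : R); apply/andP; split; nra.
Qed.

Definition cell_map n i (x : pt R) : pt R := (rho ^+ n * x.1 + pos R n i, rho ^+ n * x.2).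

Lemma F1E x : F 1 x = (rho * x.1, rho * x.2).
Proof. by rewrite /F /qn q1E /=; congr pair; rewrite subr0 addr0. Qed.

Lemma F2E x : F 2 x = (rho * x.1 + rho * rho, rho * x.2).
Proof.
rewrite /F /qn q2E -[Defs.ratio R 2]/rho /= subr0 addr0; congr pair.
by rewrite rho_sqr; ring.
Qed.

(** Children append their letter at the end of the word, hence the induction from the right. *)
Lemma word_cell_map (s : seq nat) : all (fun i => (i == 1%N) || (i == 2%N)) s ->
  exists2 i, (i <= size (pattern (size s)))%N & forall x, Fw s x = cell_map (size s) i x.
Proof.
elim/last_ind: s => [|s a IH].
  by exists 0%N => // x; rewrite /cell_map /= pos0 expr0 !mul1r addr0; case: x.
rewrite all_rcons => /andP[ha /IH[i hi H]]; rewrite size_rcons.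
have hb := child_bound _ _ hi.
case/orP: ha => /eqP ->.
  exists (child (pattern (size s)) i); first by rewrite ltnW.
  move=> x; rewrite /Fw foldr_rcons -/(Fw s _) H F1E /cell_map /= pos_child // exprSr !mulrA //.
exists (child (pattern (size s)) i).+1; first by [].
move=> x; rewrite /Fw foldr_rcons -/(Fw s _) H F2E /cell_map /= pos_childS // !exprSr.
by congr pair; ring.
Qed.

Lemma cell_map_word n i : (i <= size (pattern n))%N -> exists s : seq nat,
  [/\ all (fun i => (i == 1%N) || (i == 2%N)) s, size s = n &
      forall x, Fw s x = cell_map n i x].
Proof.
elim: n i => [|n IH] j.
  rewrite leqn0 => /eqP ->; exists [::]; split => // x.
  by rewrite /cell_map /= pos0 expr0 !mul1r addr0; case: x.
move=> /child_surj[i hi hj]; have [s [h1 h2 h3]] := IH i hi.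
case: hj => ->.
  exists (rcons s 1%N); rewrite all_rcons size_rcons h2; split => // x.
  by rewrite /Fw foldr_rcons -/(Fw s _) h3 F1E /cell_map pos_child // exprSr !mulrA.
exists (rcons s 2%N); rewrite all_rcons size_rcons h2; split => // x.
rewrite /Fw foldr_rcons -/(Fw s _) h3 F2E /cell_map pos_childS // !exprSr /=.
by congr pair; ring.
Qed.

Definition node n i : pt R := cell_map n i (q R o0).

Lemma nodeE n i : node n i = (rho ^+ n / 2 + pos R n i, rho ^+ n * (Num.sqrt 3 / 2)).
Proof. by rewrite /node /cell_map q0E /= mul1r. Qed.

Lemma node_inj n i m j : node n i = node m j -> n = m /\ i = j.
Proof.
rewrite !nodeE => -[]; have /andP[s1 _] := sqrt3_bounds.
have rh0 := rho_gt0 R; have rh1 := rho_lt1 R.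
move=> e1 e2; have en : n = m.
  have : rho ^+ n = rho ^+ m by apply: (mulIf _ e2); rewrite mulf_neq0 ?invr_eq0 // gt_eqF //; lra.
  apply: contra_eq; rewrite neq_ltn => /orP[] h; [rewrite gt_eqF|rewrite lt_eqF] => //;
    by rewrite ltr_iXn2l.
by move: e1; rewrite en => /addrI /pos_inj.
Qed.

Lemma F0q0 : F 0 (q R o0) = q R o0.
Proof. by rewrite /F /qn -/o0 !subrr !mulr0 !add0r; case: (q R o0). Qed.

(** Since 1 - rho^2 = rho, the point F_0 q_1 = rho q_0 = F_1 q_0 is the left child; likewise F_0 q_2
    = F_2 q_0. *)
Lemma F0q1 n i : (i <= size (pattern n))%N ->
  cell_map n i (F 0 (q R o1)) = node n.+1 (child (pattern n) i).
Proof.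
move=> h; rewrite nodeE /F /qn -/o0 q0E q1E -[Defs.ratio R 0]/(rho ^+ 2) /cell_map /= pos_child // expr2 rho_sqr exprSr.
by congr pair; field.
Qed.

Lemma F0q2 n i : (i <= size (pattern n))%N ->
  cell_map n i (F 0 (q R o2)) = node n.+1 (child (pattern n) i).+1.
Proof.
move=> h; rewrite nodeE /F /qn -/o0 q0E q2E -[Defs.ratio R 0]/(rho ^+ 2) /cell_map /=.
rewrite pos_childS // expr2 !exprSr -(mulrA (rho ^+ n) rho rho) rho_sqr.
by congr pair; field.
Qed.

Definition cells : set (nat * nat) := [set c | (c.2 <= size (pattern c.1))%N].

(** Cells correspond to the distinct maps, because the image of q_0 already determines the cell. All
    words with the same map have the same length, so the choice made by [W1] does not affect the
    weights. *)
Lemma enumerate_W1 (W1 : set (seq nat)) : valid_W1 R W1 -> exists w : nat * nat -> seq nat,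
  set_bij cells W1 w /\ (forall c, cells c -> size (w c) = c.1.+1 /\
    forall x, Fw (w c) x = cell_map c.1 c.2 (F 0 x)).
Proof.
move=> [V1 V2].
have word_cell v : wordform v -> exists c, [/\ cells c, size v = c.1.+1 &
    forall x, Fw v x = cell_map c.1 c.2 (F 0 x)].
  move=> [s [hs ->]]; have [i hi H] := word_cell_map s hs.
  exists (size s, i); split => //; first by rewrite size_rcons.
  by move=> x; rewrite /Fw foldr_rcons -/(Fw s _) H.
have uniq c c' : (forall x, cell_map c.1 c.2 (F 0 x) = cell_map c'.1 c'.2 (F 0 x)) -> c = c'.
  move=> /(_ (q R o0)); rewrite F0q0 => /node_inj[].
  by case: c c' => [? ?] [? ?] /= -> ->.
have ex c : exists w, cells c -> [/\ W1 w, size w = c.1.+1 &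
    forall x, Fw w x = cell_map c.1 c.2 (F 0 x)].
  have [hc|hc] := pselect (cells c); last by exists [::].
  have [s [h1 h2 h3]] := cell_map_word c.1 c.2 hc.
  have wf : wordform (rcons s 0%N) by exists s.
  have [w [[Ww hw] _]] := V2 _ wf.
  have hw' x : Fw w x = cell_map c.1 c.2 (F 0 x).
    by rewrite hw /Fw foldr_rcons -/(Fw s _) h3.
  exists w => _; split => //.
  have [c' [_ sc' hc']] := word_cell w (V1 w Ww).
  by rewrite sc' (uniq c c') // => x; rewrite -hw' hc'.
have [w hw] := choice ex; exists w; split; last first.
  by move=> c /hw[].
split.
- by move=> c /= /hw[].
- move=> c c' /set_mem /hw[_ _ H] /set_mem /hw[_ _ H'] e.
  by apply: uniq => x; rewrite -H -H' e.
move=> v Wv; have [c [hc sc H]] := word_cell v (V1 v Wv).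
exists c => //; have [Ww sw hww] := hw c hc.
have [v' [_ U]] := V2 v (V1 v Wv).
have <- := U v (conj Wv (fun x => erefl)).
by apply/esym/U; split => // x; rewrite hww H.
Qed.

Lemma esum_cells (G : nat * nat -> R) : (forall c, 0 <= G c) ->
  \esum_(c in cells) (G c)%:E = (\sum_(n <oo) (\sum_(i < (size (pattern n)).+1) G (n, (i : nat)))%:E)%E.
Proof.
move=> G0; have S0 n : 0 <= \sum_(i < (size (pattern n)).+1) G (n, (i : nat)) by apply: sumr_ge0.
rewrite nneseries_esumT => [|n]; last by rewrite lee_fin.
pose J n := `I_((size (pattern n)).+1).
transitivity (\esum_(n in [set: nat]) \esum_(i in J n) (G (n, i))%:E)%E.
  rewrite esum_esum => [|*]; last by rewrite lee_fin.
  have -> : cells = setT `*`` J by apply/seteqP; split => -[n i] /=; rewrite /cells /J /= ltnS // => -[].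
  by apply: eq_esum => -[].
apply: eq_esum => n _; rewrite esum_fset => [||i _]; [|exact: finite_II|by rewrite lee_fin].
by rewrite /J -(fsbig_ord _ _ (fun i => (G (n, i))%:E)) sumEFin.
Qed.

Lemma series_le (x : nat -> R) M : (forall n, 0 <= x n) ->
  ((\sum_(n <oo) (x n)%:E <= M%:E)%E <-> forall n, \sum_(m < n) x m <= M).
Proof.
move=> x0; split=> [h n|h].
  rewrite -lee_fin; apply: le_trans h; rewrite -sumEFin -(big_mkord xpredT (fun m => (x m)%:E)).
  by apply: nneseries_lim_ge => m _ _; rewrite lee_fin.
apply: lime_le; first by apply: is_cvg_nneseries => m _ _; rewrite lee_fin.
by apply: nearW => n; rewrite big_mkord sumEFin lee_fin.
Qed.

End Gasket.

(** * The renormalized form in terms of the traces *)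

Section Renormalization.
Variable R : realType.
Local Notation rho := (rho R).
Implicit Types (phi : nat -> nat -> R) (f : pt R -> R) (u : 'I_3 -> R) (a : 'M[R]_3).

(** Subtracting the value at q_0 is harmless, as the form depends on differences only. *)
Lemma Psi_le (W1 : set (seq nat)) r a t f u M : valid_W1 R W1 -> 0 < r -> 0 <= t ->
  0 < a o0 o1 ->
  (forall v, Dform a v v = a o0 o1 * cell_form R t (v o0) (v o1) (v o2)) ->
  (Psi W1 r a f <= (a o0 o1 * M)%:E)%E <->
  energy_le R t r (fun n i => f (node R n i) - u o0) M.
Proof.
move=> hW r0 t0 a0 hD; have [w [bw hw]] := enumerate_W1 R W1 hW.
set phi := fun n i => _.
pose G (c : nat * nat) := a o0 o1 * (r ^- c.1 * cell_form R t (phi c.1 c.2)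
  (phi c.1.+1 (child (pattern c.1) c.2)) (phi c.1.+1 (child (pattern c.1) c.2).+1)).
have G0 c : 0 <= G c.
  by rewrite mulr_ge0 ?(ltW a0) // mulr_ge0 ?cell_form_ge0 // invr_ge0 exprn_ge0 // ltW.
have -> : Psi W1 r a f = (\esum_(c in cells) (G c)%:E)%E.
  rewrite /Psi (reindex_esum cells W1 w) //; apply: eq_esum => c hc.
  have [sc H] := hw c hc; congr EFin; rewrite hD !H F0q0 F0q1 // F0q2 // sc subn1 /= /G mulrCA.
  rewrite /phi /node; congr (_ * (_ * _)); rewrite /cell_form; ring.
rewrite esum_cells // (series_le R (fun n => \sum_(i < (size (pattern n)).+1) G (n, (i : nat))));
  last by move=> n; apply: sumr_ge0.
have E n : \sum_(m < n) \sum_(i < (size (pattern m)).+1) G ((m : nat), (i : nat))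
    = a o0 o1 * energy R (cell_form R t) r phi n.
  rewrite /energy mulr_sumr; apply: eq_bigr => m _.
  by rewrite /level /cellsum !mulr_sumr.
by split=> H n; move: (H n); rewrite E ler_pM2l.
Qed.

Lemma V1_node (W1 : set (seq nat)) x : valid_W1 R W1 -> V1 W1 x <->
  exists n i, (i <= size (pattern n))%N /\ x = node R n i.
Proof.
move=> hW; have [w [[w1 w2 w3] hw]] := enumerate_W1 R W1 hW; split.
  move=> [v [Wv [j ->]]]; have [c hc <-] := w3 v Wv.
  have [_ ->] := hw c hc; have hc' : (c.2 <= size (pattern c.1))%N := hc.
  have hb := child_bound _ _ hc'.
  case: (ord3_cases j) => ->.
  - by rewrite F0q0; exists c.1, c.2; split.
  - by rewrite F0q1 //; exists c.1.+1, (child (pattern c.1) c.2); split=> //; rewrite ltnW.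
  - by rewrite F0q2 //; exists c.1.+1, (child (pattern c.1) c.2).+1; split.
move=> [n [i [hi ->]]]; exists (w (n, i)); split; first exact: (w1 (n, i)).
by exists o0; have [_ ->] := hw (n, i) hi; rewrite F0q0.
Qed.

Lemma node00 : node R 0 0 = q R o0.
Proof. by rewrite nodeE q0E pos0 expr0 addr0 !mul1r. Qed.

Lemma max_norm_lt (x y p d : R) : `|x| = y / 2 + p -> 0 < y -> 0 <= p -> y + p < d ->
  Num.max `|x| `|y * (Num.sqrt 3 / 2)| < d.
Proof.
move=> -> y0 p0 h; have /andP[s1 s2] := sqrt3_bounds R; rewrite gt_max.
by rewrite (ger0_norm (_ : 0 <= y * _)); [apply/andP; split|]; nra.
Qed.

Lemma boundary_of_admissible (W1 : set (seq nat)) r a u f : valid_W1 R W1 ->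
  admissible W1 r a u f ->
  boundary R (fun n i => f (node R n i) - u o0) (u o1 - u o0) (u o2 - u o0).
Proof.
move=> hW [_ [fu fc]].
have rp n : 0 < rho ^+ n by rewrite exprn_gt0 // rho_gt0.
split; first by rewrite node00 fu subrr.
- move=> e e0; have [d d0 H] := fc o1 e e0; exists d => // n i hi hd.
  have -> : f (node R n i) - u o0 - (u o1 - u o0) = f (node R n i) - f (q R o1) by rewrite fu; ring.
  apply: H; first by apply/V1_node => //; exists n, i.
  rewrite nodeE q1E /= !subr0; apply: max_norm_lt (rp n) (pos_ge0 R n i) hd.
  by rewrite ger0_norm // addr_ge0 ?pos_ge0 // divr_ge0 // ltW.
move=> e e0; have [d d0 H] := fc o2 e e0; exists d => // n i hi hd; rewrite /reflect.
have -> : f (node R n (size (pattern n) - i)%N) - u o0 - (u o2 - u o0)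
  = f (node R n (size (pattern n) - i)%N) - f (q R o2) by rewrite fu; ring.
apply: H; first by apply/V1_node => //; exists n, (size (pattern n) - i)%N; rewrite leq_subr.
rewrite nodeE q2E pos_rev //= subr0; apply: max_norm_lt (rp n) (pos_ge0 R n i) hd.
have -> : rho ^+ n / 2 + (1 - rho ^+ n - pos R n i) - 1 = - (rho ^+ n / 2 + pos R n i) by field.
by rewrite normrN ger0_norm // addr_ge0 ?pos_ge0 // divr_ge0 // ltW.
Qed.

Definition node_index (x : pt R) : nat * nat :=
  xget (0%N, 0%N) [set c | cells c /\ node R c.1 c.2 = x].

Lemma node_indexK n i : (i <= size (pattern n))%N -> node_index (node R n i) = (n, i).
Proof.
move=> hi; have [|_] := @xgetPex _ (0%N, 0%N) [set c | cells c /\ node R c.1 c.2 = node R n i].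
  by exists (n, i).
rewrite -/(node_index _) => /node_inj[]; by case: (node_index _) => [? ?] /= -> ->.
Qed.

(** q_1 and q_2 lie at height 0 and are not nodes, so their values are set separately. *)
Definition of_nodes u phi (x : pt R) : R :=
  if x == q R o1 then u o1 else if x == q R o2 then u o2
  else phi (node_index x).1 (node_index x).2 + u o0.

Lemma of_nodesE u phi n i : (i <= size (pattern n))%N ->
  of_nodes u phi (node R n i) = phi n i + u o0.
Proof.
move=> hi; have /andP[s1 s2] := sqrt3_bounds R.
have p0 : 0 < rho ^+ n * (Num.sqrt 3 / 2).
  by rewrite mulr_gt0 ?divr_gt0 // ?exprn_gt0 ?rho_gt0 //; lra.
rewrite /of_nodes node_indexK //= nodeE q1E q2E !xpair_eqE (gt_eqF p0) !andbF //.
Qed.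

Lemma admissible_of_boundary (W1 : set (seq nat)) r a u phi : valid_W1 R W1 ->
  boundary R phi (u o1 - u o0) (u o2 - u o0) ->
  (Psi W1 r a (of_nodes u phi) < +oo)%E -> admissible W1 r a u (of_nodes u phi).
Proof.
move=> hW [h0 h1 h2] hPsi; have /andP[s1 s2] := sqrt3_bounds R.
have rp n : 0 < rho ^+ n by rewrite exprn_gt0 // rho_gt0.
have rh1 := rho_lt1 R.
have fu i : of_nodes u phi (q R i) = u i.
  case: (ord3_cases i) => ->.
  - by rewrite -node00 of_nodesE // h0 add0r.
  - by rewrite /of_nodes eqxx.
  rewrite /of_nodes eqxx; case: eqP => // e; move: e; rewrite q1E q2E => -[] /eqP.
  by rewrite oner_eq0.
split => //; split => // i e e0; rewrite fu; case: (ord3_cases i) => ->.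
(* q_0 is isolated in V_1: within this radius no node of level at least 1 is high enough. *)
- exists (Num.sqrt 3 / 2 * (1 - rho)); first by rewrite mulr_gt0 //; lra.
  move=> x /(V1_node _ _ hW)[n [j [hj ->]]]; rewrite of_nodesE // gt_max => /andP[_].
  rewrite nodeE q0E /=; case: n hj => [|n] hj.
    by move=> _; move: hj; rewrite leqn0 => /eqP ->; rewrite h0 add0r subrr normr0.
  have : rho ^+ n.+1 <= rho.
    by rewrite exprS ler_piMr ?(ltW (rho_gt0 R)) // exprn_ile1 // ltW // rho_gt0.
  set y := rho ^+ n.+1 => hy; rewrite ltr_norml => /andP[h _]; exfalso.
  have : 0 < Num.sqrt 3 / 2 :> R by lra.
  nra.
- have [d d0 H] := h1 e e0; exists (d / 2); first by rewrite divr_gt0.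
  move=> x /(V1_node _ _ hW)[n [j [hj ->]]]; rewrite of_nodesE // gt_max => /andP[].
  rewrite nodeE q1E /= subr0 => h _.
  have -> : phi n j + u o0 - u o1 = phi n j - (u o1 - u o0) by ring.
  apply: H => //; move: h; rewrite ltr_norml => /andP[_ h].
  by have := rp n; have := pos_ge0 R n j; lra.
have [d d0 H] := h2 e e0; exists (d / 2); first by rewrite divr_gt0.
move=> x /(V1_node _ _ hW)[n [j [hj ->]]]; rewrite of_nodesE // gt_max => /andP[].
rewrite nodeE q2E /= => h _.
have -> : phi n j + u o0 - u o2 = reflect R phi n (size (pattern n) - j)%N - (u o2 - u o0).
  by rewrite /reflect subKn //; ring.
apply: H; first exact: leq_subr.
move: h; rewrite ltr_norml => /andP[h _]; rewrite pos_rev //.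
have := pos_ge0 R n (size (pattern n) - j); rewrite pos_rev //.
by have := rp n; lra.
Qed.

Lemma energy_eq t r phi psi n : (forall m i, (i <= size (pattern m))%N -> phi m i = psi m i) ->
  energy R (cell_form R t) r phi n = energy R (cell_form R t) r psi n.
Proof.
move=> h; apply: eq_bigr => m _; congr (_ * _); apply: eq_bigr => i _.
have hi : (i <= size (pattern m))%N by rewrite -ltnS.
have hb := child_bound _ _ hi.
by rewrite !h // ltnW.
Qed.

(** Competitors for the trace form become admissible functions by [of_nodes], and admissible
    functions restrict to competitors on the nodes. *)
Lemma RrE (W1 : set (seq nat)) r a t u : valid_W1 R W1 -> rho < r -> 0 <= t -> 0 < a o0 o1 ->
  (forall v, Dform a v v = a o0 o1 * cell_form R t (v o0) (v o1) (v o2)) ->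
  Rr W1 r a u = (a o0 o1 * ((2 * u o0 - u o1 - u o2) ^+ 2 / 2 * trace R (-1) r t
    + (u o1 - u o2) ^+ 2 / 2 * trace R 1 r t))%:E.
Proof.
move=> hW hr t0 a0 hD; have r0 : 0 < r by apply: lt_trans hr; apply: rho_gt0.
set y := u o1 - u o0; set z := u o2 - u o0.
have VE : (2 * u o0 - u o1 - u o2) ^+ 2 / 2 * trace R (-1) r t
    + (u o1 - u o2) ^+ 2 / 2 * trace R 1 r t
  = 2 * ((y + z) / 2) ^+ 2 * trace R (-1) r t + 2 * ((z - y) / 2) ^+ 2 * trace R 1 r t.
  by rewrite /y /z; field.
rewrite VE; set V := _ + _; apply/eqP; rewrite eq_le; apply/andP; split.
  apply/lee_addgt0Pr => e e0.
  have ea : 0 < e / a o0 o1 by rewrite divr_gt0.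
  have [phi hb he] := trace_form_upper R r t y z (e / a o0 o1) hr t0 ea.
  rewrite -/V in he.
  have hP : (Psi W1 r a (of_nodes u phi) <= (a o0 o1 * (V + e / a o0 o1))%:E)%E.
    apply/(Psi_le W1 r a t _ u) => // n; apply: le_trans (he n).
    rewrite le_eqVlt; apply/orP; left; apply/eqP; apply: energy_eq => m i hi.
    by rewrite of_nodesE // addrK.
  apply: le_trans (_ : Psi W1 r a (of_nodes u phi) <= _)%E.
    apply: ereal_inf_lbound; exists (of_nodes u phi) => //.
    by apply: admissible_of_boundary => //; apply: le_lt_trans hP (ltry _).
  apply: le_trans hP _; rewrite -EFinD lee_fin le_eqVlt; apply/orP; left; apply/eqP.
  by (field; rewrite gt_eqF).
apply: le_ereal_inf_tmp => _ [f hf <-].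
have hb := boundary_of_admissible W1 r a u f hW hf; have [hfin _] := hf.
have P0 : (0 <= Psi W1 r a f)%E.
  apply: esum_ge0 => w _; rewrite lee_fin hD.
  by rewrite !mulr_ge0 ?cell_form_ge0 ?(ltW a0) // invr_ge0 exprn_ge0 // ltW.
have Pfin : Psi W1 r a f \is a fin_num by rewrite ge0_fin_numE.
rewrite -(fineK Pfin) lee_fin -ler_pdivlMl // mulrC.
apply: (trace_form_lower R r t _ y z _ hr t0 hb).
apply/(Psi_le W1 r a t f u) => //.
have -> : a o0 o1 * (fine (Psi W1 r a f) / a o0 o1) = fine (Psi W1 r a f) by (field; rewrite gt_eqF).
by rewrite fineK.
Qed.

(** If a_01 = a_02 = 0, no edge leaves q_0 and no path reaches q_1. *)
Lemma irreducible_pos a : in_MS a -> 0 < a o0 o1 /\ 0 <= a o1 o2.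
Proof.
move=> [[sa [da [pa irr]]] e]; split => //; rewrite lt_neqAle pa andbT eq_sym.
apply/eqP => a0; have /connectP[p hp hl] := irr o0 o1.
case: p hp hl => [_ /(congr1 val)|x p /= /andP[h _] _]; first by rewrite /= !inordK.
have a02 : a o0 o2 = 0 by rewrite -[LHS]e.
by move: h; case: (ord3_cases x) => ->; rewrite ?da ?a0 ?a02 ltxx.
Qed.

Definition conductances (b : R) : 'M[R]_3 :=
  \matrix_(i, j) (if i == j then 0 else if (i == o0) || (j == o0) then 1 else b).

Lemma conductances_MS b : 0 <= b -> in_MS (conductances b) /\
  conductances b o0 o1 = 1 /\ conductances b o1 o2 = b.
Proof.
move=> b0; have n01 : o0 != o1 by rewrite -val_eqE /= !inordK.
have n02 : o0 != o2 by rewrite -val_eqE /= !inordK.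
have n12 : o1 != o2 by rewrite -val_eqE /= !inordK.
have e01 : conductances b o0 o1 = 1 by rewrite mxE (negbTE n01) eqxx.
have e02 : conductances b o0 o2 = 1 by rewrite mxE (negbTE n02) eqxx.
have e12 : conductances b o1 o2 = b.
  by rewrite mxE (negbTE n12) [o1 == _]eq_sym (negbTE n01) [o2 == _]eq_sym (negbTE n02).
have sym i j : conductances b i j = conductances b j i by rewrite !mxE eq_sym orbC.
split; last by [].
split; last by rewrite -/o0 -/o1 -/o2 e01.
split=> //; split; first by move=> i; rewrite mxE eqxx.
split; first by move=> i j; rewrite mxE; case: ifP => // _; case: ifP.
have from0 j : connect (fun k l => 0 < conductances b k l) o0 j.
  by case: (ord3_cases j) => ->; [exact: connect0|apply: connect1|apply: connect1];
    rewrite ?e01 ?e02.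
have to0 i : connect (fun k l => 0 < conductances b k l) i o0.
  by case: (ord3_cases i) => ->; [exact: connect0|apply: connect1|apply: connect1];
    rewrite sym ?e01 ?e02.
by move=> i j; apply: connect_trans (to0 i) (from0 j).
Qed.

End Renormalization.

Theorem theorem5p7 (R : realType) (W1 : set (seq nat)) :
  valid_W1 R W1 ->
  exists! r : R, (rho R < r < 1) /\
    exists a : 'M[R]_3, in_MS a /\
      forall u : 'I_3 -> R,
        Rr W1 r a u = ((r ^+ 2 * Dform a u u)%:E)%E.
Proof.
move=> hW.
have eigen r : rho R < r < 1 -> (exists a : 'M[R]_3, in_MS a /\
    forall u : 'I_3 -> R, Rr W1 r a u = ((r ^+ 2 * Dform a u u)%:E)%E) ->
  exists t, [/\ 1 <= t, trace R (-1) r t = r ^+ 2 & trace R 1 r t = t * r ^+ 2].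
  move=> /andP[hr _] [a [ha H]]; have [a0 b0] := irreducible_pos R a ha.
  have hD v := Dform_cell R a v ha a0; set t := 1 + _ in hD.
  have t1 : 1 <= t by rewrite lerDl divr_ge0 ?mulr_ge0 // ltW.
  have t0 : 0 <= t by lra.
  have aN : a o0 o1 != 0 by rewrite gt_eqF.
  have E u : (2 * u o0 - u o1 - u o2) ^+ 2 / 2 * trace R (-1) r t
      + (u o1 - u o2) ^+ 2 / 2 * trace R 1 r t = r ^+ 2 * cell_form R t (u o0) (u o1) (u o2).
    have := H u; rewrite (RrE R W1 r a t u hW hr t0 a0 hD) hD => -[].
    by rewrite mulrCA => /(mulfI aN).
  have i10 : o1 == o0 = false by rewrite -val_eqE /= !inordK.
  have i20 : o2 == o0 = false by rewrite -val_eqE /= !inordK.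
  have i12 : o1 == o2 = false by rewrite -val_eqE /= !inordK.
  exists t; split => //.
    (* The data (0, -1, -1) have s = 2, tau = 0 and isolate A; below, (0, -1, 1) have s = 0, tau = 2
       and isolate G. *)
    have := E (fun i => if i == o0 then 0 else -1).
    by rewrite eqxx i10 i20 /cell_form => h; lra.
  have := E (fun i => if i == o0 then 0 else if i == o2 then 1 else -1).
  by rewrite !eqxx i10 i20 i12 /cell_form => h; lra.
have [r [t [hr t1 eA eG]]] := eigenform_exists R.
exists r; split.
  split => //; have /andP[hr1 _] := hr.
  (* The solution b of t = 1 + 2 b, with a_01 normalized to 1. *)
  have b0 : 0 <= (t - 1) / 2 by lra.
  have [ha [e01 e12]] := conductances_MS R _ b0.
  exists (conductances R ((t - 1) / 2)); split => // u.
  have a0 : 0 < conductances R ((t - 1) / 2) o0 o1 by rewrite e01.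
  have hD v := Dform_cell R _ v ha a0.
  have et : 1 + 2 * conductances R ((t - 1) / 2) o1 o2 / conductances R ((t - 1) / 2) o0 o1 = t.
    by rewrite e01 e12; field.
  rewrite et in hD; have t0 : 0 <= t by lra.
  rewrite (RrE R W1 r _ t u hW hr1 t0 a0 hD) hD e01 eA eG; congr EFin.
  by rewrite /cell_form; ring.
move=> r' [hr' /(eigen r' hr')[t' [t'1 eA' eG']]].
exact: (eigenform_unique R r r' t t').
Qed.
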